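(* Let $\Gamma$ be a sofic group, let $n\ge 1$, and let $A\in M_n(\mathbb{Z}\Gamma)$, acting on $(\ell^2\Gamma)^{\oplus n}$ by left convolution. Let $(\phi_{F,\epsilon})$ be a family of sofic approximations of $\Gamma$ indexed by the directed set of pairs $(F,\epsilon)$, as specified in the context. Then: (i) All eigenvalues of $A$ (acting on $(\ell^2\Gamma)^{\oplus n}$) are algebraic integers. (ii) For all $\lambda\in\mathbb{C}$, the approximation formula holds: $$\dim_{L\Gamma}\ker(\lambda\cdot\mathrm{id}-A)=\lim_{(F,\epsilon)\to\infty}\frac{\dim_{\mathbb{C}}\ker(\lambda\cdot\mathrm{id}-\phi_{F,\epsilon}(A))}{n_{F,\epsilon}}.$$ (iii) If $\alpha\in\mathbb{C}$ is an eigenvalue of $A$, then all Galois conjugates of $\alpha$ are also eigenvalues of $A$, and the corresponding eigenspaces have the same von Neumann dimension.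
   Context: $\Gamma$ is a discrete group. For $\sigma\in S_m$ let $\#_1\sigma$ denote the number of fixed points of $\sigma$. $\Gamma$ is called sofic if for every real $0<\epsilon<1$ and every finite subset $F\subseteq\Gamma$ there exist a natural number $m$ and a map $\phi\colon\Gamma\to S_m$ such that: (1) $\#_1\big(\phi(g)\phi(h)\phi(gh)^{-1}\big)\ge(1-\epsilon)m$ for all $g,h\in F$; (2) $\phi(e)=e$; (3) $\#_1\phi(g)\le\epsilon m$ for all $e\ne g\in F$. When $F$ is symmetric ($F^{-1}=F$) one may moreover assume $\phi(g^{-1})=\phi(g)^{-1}$ for $g\in F$. Pairs $(F,\epsilon)$ of a finite symmetric subset $F\subset\Gamma$ and a real number $0<\epsilon<1$ are directed by $(F,\epsilon)\le(F',\epsilon')$ iff $F\subset F'$ and $\epsilon\ge\epsilon'$. For each $(F,\epsilon)$ fix a map $\phi_{F,\epsilon}\colon\Gamma\to S_{n_{F,\epsilon}}$ satisfying (1)-(3) for $(F,\epsilon)$ and $\phi_{F,\epsilon}(g^{-1})=\phi_{F,\epsilon}(g)^{-1}$ for $g\in F$. Composing with the representation of $S_m$ by permutation matrices and extending linearly gives a linear map $\phi_{F,\epsilon}\colon\mathbb{C}\Gamma\to M_{n_{F,\epsilon}}(\mathbb{C})$; applied entrywise it gives $\phi_{F,\epsilon}\colon M_n(\mathbb{C}\Gamma)\to M_n(M_{n_{F,\epsilon}}(\mathbb{C}))=M_{n\cdot n_{F,\epsilon}}(\mathbb{C})$. The limit is the limit of the net over the directed set of pairs. $\ell^2\Gamma$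 is the Hilbert space with orthonormal basis $\Gamma$; $L\Gamma$ is the von Neumann algebra of bounded operators on $\ell^2\Gamma$ commuting with the right convolution action of $\Gamma$, with trace $\tau(T)=\langle T\delta_e,\delta_e\rangle$. The von Neumann dimension $\dim_{L\Gamma}V$ of a closed right-$\Gamma$-invariant subspace $V\subseteq(\ell^2\Gamma)^{\oplus n}$ is $\sum_{i=1}^n\tau(P_{ii})$, where $P=(P_{ij})\in M_n(L\Gamma)$ is the orthogonal projection onto $V$. The Galois conjugates of an algebraic number are the complex roots of its minimal polynomial over $\mathbb{Q}$. *)

(* Defs.v *)
From HB Require Import structures.
From mathcomp Require Import all_boot all_order all_fingroup all_algebra.
From mathcomp Require Import finmap.
From mathcomp Require Import all_classical all_reals all_analysis.
From mathcomp Require Import complex.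
From mathcomp Require summability.

Set Implicit Arguments.
Unset Strict Implicit.
Unset Printing Implicit Defensive.

Import Order.TTheory GRing.Theory Num.Theory.
Import numFieldNormedType.Exports.

Local Open Scope classical_set_scope.
Local Open Scope ring_scope.

Section GroupRing.
Variable G : groupType.

(* The group ring K[G]: finitely supported coefficient functions. *)
Definition gring (K : nzRingType) := {fsfun G -> K with 0}.

Definition gring_map (K L : nzRingType) (f : K -> L) (a : gring K) : gring L :=
  [fsfun g in finsupp a => f (a g)].

End GroupRing.

Section Hilbert.
Variables (R : realType) (G : groupType).
Local Notation C := R[i].

(* Unordered sum over the possibly uncountable G: the limit of the finite
   partial sums. C^o is C with its usual topology. *)
Definition usum (x : G -> C) : C := summability.sum (x : G -> C^o).

Definition l2 : set (G -> C) :=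
  [set x | summable setT (fun g => (Normc.normc (x g) ^+ 2)%:E)].

Definition l2_dot (x y : G -> C) : C := usum (fun g => x g * conjc (y g)).

Definition delta (g : G) : G -> C := fun h => (h == g)%:R.

Section DirectSum.
Variable n : nat.

(* Vectors of (l^2 G)^n are the elements x of 'I_n -> G -> C with l2n x. *)
Definition l2n : set ('I_n -> G -> C) := [set x | forall i, l2 (x i)].

Definition l2n_dot (x y : 'I_n -> G -> C) : C := \sum_i l2_dot (x i) (y i).

Definition l2n_inj (j : 'I_n) (x : G -> C) : 'I_n -> G -> C :=
  fun i g => if i == j then x g else 0.

(* Left convolution: h sends delta k to delta (h * k). *)
Definition lconv (a : gring G C) (x : G -> C) : G -> C :=
  fun g => \sum_(h <- finsupp a) a h * x (h^-1 * g)%g.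

Definition mxconv (A : 'M[gring G C]_n) (x : 'I_n -> G -> C) :
    'I_n -> G -> C :=
  fun i g => \sum_j lconv (A i j) (x j) g.

(* The kernel of lam * id - A on (l^2 G)^n. *)
Definition l2_eigenspace (A : 'M[gring G C]_n) (lam : C) :
    set ('I_n -> G -> C) :=
  [set x | l2n x /\ forall i g, lam * x i g - mxconv A x i g = 0].

Definition l2_eigenvalue (A : 'M[gring G C]_n) (lam : C) : Prop :=
  exists2 x, l2_eigenspace A lam x & exists i g, x i g != 0.

(* The orthogonal projection of x onto V: the y in V with x - y orthogonal to
   V. It exists and is unique when V is a closed subspace of (l^2 G)^n and x
   is in (l^2 G)^n; otherwise a default value may be returned. *)
Definition ortho_proj (V : set ('I_n -> G -> C)) (x : 'I_n -> G -> C) :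
    'I_n -> G -> C :=
  xget (fun _ _ => 0)
    [set y | V y /\
             forall v, V v -> l2n_dot (fun i g => x i g - y i g) v = 0].

Definition op_entry (P : ('I_n -> G -> C) -> 'I_n -> G -> C) (i j : 'I_n) :
    (G -> C) -> G -> C :=
  fun x => P (l2n_inj j x) i.

Definition vN_trace (T : (G -> C) -> G -> C) : C :=
  l2_dot (T (delta 1%g)) (delta 1%g).

(* Meaningful for V closed and invariant under right translation. *)
Definition vN_dim (V : set ('I_n -> G -> C)) : C :=
  \sum_i vN_trace (op_entry (ortho_proj V) i i).

End DirectSum.
End Hilbert.

Section Sofic.
Variables (R : realType) (G : groupType).
Local Notation C := R[i].

Definition nfix m (s : 'S_m) : nat := #|[set i | s i == i]%SET|.

(* m = 0 has to be excluded: the remaining conditions hold trivially in S_0. *)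
Definition sofic_approx (F : {fset G}) (eps : R) m (phi : G -> 'S_m) : Prop :=
  [/\ (0 < m)%N,
      forall g h, g \in F -> h \in F ->
        (1 - eps) * m%:R <= (nfix (phi g * phi h * (phi (g * h))^-1)%g)%:R,
      phi 1%g = 1%g
    & forall g, g \in F -> g != 1%g -> (nfix (phi g))%:R <= eps * m%:R].

Definition sofic : Prop :=
  forall (eps : R) (F : {fset G}), 0 < eps < 1 ->
    exists m (phi : G -> 'S_m), sofic_approx F eps phi.

Record sofic_index := SoficIndex {
  idx_set : {fset G};
  idx_eps : R;
  idx_sym : [fset g^-1%g | g in idx_set]%fset == idx_set;
  idx_eps_bounds : 0 < idx_eps < 1
}.

Definition sofic_index_le (p q : sofic_index) : bool :=
  (idx_set p `<=` idx_set q)%fset && (idx_eps q <= idx_eps p).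

Definition sofic_limit : set_system sofic_index :=
  filter_from setT (fun p => [set q | sofic_index_le p q]).

Definition sofic_family (m : sofic_index -> nat)
    (phi : forall p, G -> 'S_(m p)) : Prop :=
  forall p, sofic_approx (idx_set p) (idx_eps p) (phi p) /\
    forall g, g \in idx_set p -> phi p g^-1%g = (phi p g)^-1%g.

(* The product s * t of 'S_m means "first s, then t"; perm_mx is multiplicative
   for this product, hence it is the permutation representation. *)
Definition perm_lin m (phi : G -> 'S_m) (a : gring G C) : 'M[C]_m :=
  \sum_(g <- finsupp a) a g *: perm_mx (phi g).

Definition perm_lin_mx n m (phi : G -> 'S_m) (A : 'M[gring G C]_n) :=
  \mxblock_(i < n, j < n) perm_lin phi (A i j).

(* cokermx spans the kernel of a matrix acting on column vectors. *)
Definition dim_ker k (M : 'M[C]_k) : nat := \rank (cokermx M).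

End Sofic.

Section Algebraic.
Variable R : realType.
Local Notation C := R[i].

Definition is_minpoly (a : C) (p : {poly rat}) : Prop :=
  [/\ p \is monic, root (map_poly ratr p) a
    & forall q : {poly rat}, q != 0 -> root (map_poly ratr q) a ->
        (size p <= size q)%N].

Definition galois_conj (a b : C) : Prop :=
  exists2 p, is_minpoly a p & root (map_poly ratr p) b.

Definition algebraic_integer (a : C) : Prop :=
  integralOver (intr : int -> C) a.

End Algebraic.

(* Main.v *)
From HB Require Import structures.
Require Import Defs.
From mathcomp Require Import all_boot all_order all_fingroup all_algebra.
From mathcomp Require Import finmap.
From mathcomp Require Import all_classical all_reals all_analysis.
From mathcomp Require Import complex.
From mathcomp Require Import cyclic separable cyclotomic.
From mathcomp Require Import ring lra zify.

Set Implicit Arguments.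
Unset Strict Implicit.
Unset Printing Implicit Defensive.

Import Order.TTheory GRing.Theory Num.Theory.
Import numFieldNormedType.Exports.

Local Open Scope ring_scope.

(** Write [B = lam - A], let [c] bound the squared norms of [B] and of
    its finite models [B_p = lam - phi_p(A)], and put [S = 1 - B^* B / c], which is
    a self-adjoint contraction with [S = 1] exactly on the kernel of [B].

    On the group side, the powers of [S] decrease to the orthogonal projection
    onto the kernel, so the von Neumann dimension is the limit of the traces
    [a_k] of [S^k] ([vN_dim_lim]). On the finite side, for a fixed [k], all but
    a small proportion of the points of the permuted set look like the unit of
    the group up to the distance that [S^k] can see; there the diagonal
    entries of [S_p^k] agree with those of [S^k], so the normalised trace of
    [S_p^k] tends to [a_k] along the net ([trace_estimate],
    [card_bad_vertices]). In particular the [a_k] inherit positivity and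
    monotonicity from the matrices [S_p], and these two facts are all that the
    convergence of [S^k] requires.

    As [S_p^k] is the identity on the kernel of [B_p], its normalised trace
    bounds the normalised dimension of that kernel from above. The excess comes
    from the nonzero eigenvalues of [B_p^* B_p]: those greater than some fixed
    [a] contribute little once [k] is large, and the small ones must be shown
    to be few, uniformly in [p]. This is the arithmetic heart of the matter
    ([few_small_sval2]); it uses only that [phi_p(A)] is an integral matrix [M]
    of bounded norm.

    - If [lam] is an algebraic integer, a nonzero minor of [lam - M] of maximal
      size is an integral polynomial in [lam]. The product of its nonzero
      conjugates is at least 1 and each of them is bounded, so the minor is not
      too small; but it is the smaller the more small nonzero singular values
      [lam - M] has ([algint_few_small_sval2]).
    - Otherwise [lam] is never an eigenvalue of [M]. The pigeonhole principle
      gives an integral polynomial [Q] that is bounded by some [C > 1] on a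
      large disc, with [Q(lam)] smaller than a prescribed power of [1 / C]
      ([dirichlet_polynomial]). The product of the nonzero values of [Q] at the
      eigenvalues of [M] is at least 1, so few eigenvalues are near [lam]. A
      point [lam'] very near [lam], taken on a circle on which the product of
      the distances to these few eigenvalues is not too small, has
      [det(lam' - M)] bounded below, which leaves room for few small singular
      values only ([nonalgint_few_small_sval2]).

    The approximation formula follows. The trace being faithful, [lam] is an
    eigenvalue of [A] exactly when the dimension of its eigenspace is nonzero
    ([vN_dim_eq0]); then it is an eigenvalue of some integral matrix [M], hence
    an algebraic integer. For conjugate numbers [a] and [b] the matrices
    [a - M] and [b - M] have the same rank, because the same minors, which are
    rational polynomials, vanish at [a] and at [b]; passing to the limit gives
    the last claim. *)

(** * Singular values and contracted subspaces *)

Section SingularValues.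
Local Open Scope sesquilinear_scope.
Context {C : numClosedFieldType}.

Definition nsq n (u : 'rV[C]_n) : C := \sum_j `|u 0 j| ^+ 2.

Definition sqbounded m n (c : C) (X : 'M[C]_(m, n)) : Prop :=
  forall u, nsq (u *m X) <= c * nsq u.

Lemma nsqE n (u : 'rV[C]_n) : nsq u = (u *m u ^t*) 0 0.
Proof. by rewrite mxE; apply: eq_bigr => j _; rewrite !mxE normCK. Qed.

Lemma nsq_ge0 n (u : 'rV[C]_n) : 0 <= nsq u.
Proof. by apply: sumr_ge0 => j _; rewrite exprn_ge0. Qed.

Lemma nsq_eq0 n (u : 'rV[C]_n) : (nsq u == 0) = (u == 0).
Proof.
rewrite psumr_eq0; last by move=> j _; rewrite exprn_ge0.
apply/allP/eqP => [u0|-> j _]; last by rewrite /= mxE normr0 expr0n eqxx.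
apply/rowP => j; rewrite mxE; apply/eqP.
by have := u0 j (mem_index_enum _); rewrite expf_eq0 normr_eq0.
Qed.

Lemma nsqZ n a (u : 'rV[C]_n) : nsq (a *: u) = `|a| ^+ 2 * nsq u.
Proof.
by rewrite mulr_sumr; apply: eq_bigr => j _; rewrite mxE normrM exprMn.
Qed.

Lemma nsqD_le n (u v : 'rV[C]_n) : nsq (u + v) <= 2 * (nsq u + nsq v).
Proof.
rewrite -big_split mulr_sumr; apply: ler_sum => j _; rewrite mxE.
apply: (@le_trans _ _ ((`|u 0 j| + `|v 0 j|) ^+ 2)).
  by rewrite lerXn2r ?nnegrE ?addr_ge0 ?ler_normD.
rewrite -subr_ge0.
have -> : 2 * (`|u 0 j| ^+ 2 + `|v 0 j| ^+ 2) - (`|u 0 j| + `|v 0 j|) ^+ 2 =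
  (`|u 0 j| - `|v 0 j|) ^+ 2 by ring.
by rewrite real_exprn_even_ge0 // rpredB ?normr_real.
Qed.

Lemma nsq_unitary n (P : 'M[C]_n) u : P \is unitarymx -> nsq (u *m P) = nsq u.
Proof.
by move=> /unitarymxP PP; rewrite !nsqE trmx_mul map_mxM mulmxA -[u *m P *m _]mulmxA PP mulmx1.
Qed.

Section OneMatrix.
Variables (m n : nat) (X : 'M[C]_(m, n)).

(** The squares of the singular values of [X], with multiplicity. *)
Definition sval2 : 'rV[C]_m := spectral_diag (X *m X ^t*).

Definition svec : 'M[C]_m := spectralmx (X *m X ^t*).

Lemma svec_unitary : svec \is unitarymx. Proof. exact: spectral_unitarymx. Qed.

Lemma gram_spectral : X *m X ^t* = svec ^t* *m diag_mx sval2 *m svec.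
Proof.
rewrite -invmx_unitary ?svec_unitary //; apply/orthomx_spectralP/normalmxP.
by rewrite trmx_mul map_mxM trmxCK.
Qed.

Lemma nsq_sval2 u :
  nsq (u *m X) = \sum_i sval2 0 i * `|(u *m svec ^t*) 0 i| ^+ 2.
Proof.
rewrite nsqE trmx_mul map_mxM !mulmxA -(mulmxA u X) gram_spectral !mulmxA.
rewrite -mulmxA mxE; apply: eq_bigr => i _.
have -> : svec *m u ^t* = (u *m svec ^t*) ^t* by rewrite trmx_mul map_mxM trmxCK.
by rewrite mul_mx_diag !mxE normCK mulrAC mulrC.
Qed.

Lemma svec_mulCt : svec *m svec ^t* = 1%:M.
Proof. exact/unitarymxP/svec_unitary. Qed.

Lemma svec_mulC : svec ^t* *m svec = 1%:M.
Proof. by apply: mulmx1C; exact: svec_mulCt. Qed.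

Lemma nsq_svecC u : nsq (u *m svec ^t*) = nsq u.
Proof. by rewrite nsq_unitary // trmxC_unitary svec_unitary. Qed.

Lemma sval2_nsq i : sval2 0 i = nsq (row i svec *m X).
Proof.
rewrite nsq_sval2 -row_mul svec_mulCt (bigD1 i) //= big1.
  by rewrite !mxE eqxx normr1 expr1n mulr1 addr0.
by move=> j ji; rewrite !mxE eq_sym (negbTE ji) normr0 expr0n mulr0.
Qed.

Lemma sval2_ge0 i : 0 <= sval2 0 i.
Proof. by rewrite sval2_nsq nsq_ge0. Qed.

Lemma nsq_row_svec i : nsq (row i svec) = 1.
Proof.
have := nsq_svecC (row i svec); rewrite -row_mul svec_mulCt => <-.
rewrite /nsq (bigD1 i) //= big1 => [|j ji].
  by rewrite !mxE eqxx normr1 expr1n addr0.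
by rewrite !mxE eq_sym (negbTE ji) normr0 expr0n.
Qed.

Lemma sval2_le c i : sqbounded c X -> sval2 0 i <= c.
Proof.
by move=> /(_ (row i svec)); rewrite -sval2_nsq nsq_row_svec mulr1.
Qed.

Definition singspace (I : {set 'I_m}) : 'M[C]_(#|I|, m) :=
  rowsub enum_val svec.

Lemma singspace_coord (I : {set 'I_m}) p (u : 'M[C]_(p, m)) k i :
  (u <= singspace I)%MS -> i \notin I -> (u *m svec ^t*) k i = 0.
Proof.
move=> /submxP[D ->] iI; rewrite -!mulmxA mxE big1 // => l _.
rewrite mul_rowsub_mx svec_mulCt !mxE.
by case: eqP => [ei|_]; [rewrite -ei enum_valP in iI | rewrite mulr0].
Qed.

Lemma rank_singspace (I : {set 'I_m}) : \rank (singspace I) = #|I|.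
Proof.
apply: mxrank_unitary; apply/unitarymxP; apply/matrixP => k l.
have /matrixP/(_ (enum_val k) (enum_val l)) := svec_mulCt.
rewrite !mxE (inj_eq enum_val_inj) => <-.
by apply: eq_bigr => j _; rewrite !mxE.
Qed.

(** On the span of the singular vectors whose value exceeds [a], no nonzero
    vector satisfies the inequality assumed on [W]; the two spaces therefore
    meet trivially. *)
Lemma rank_le_small_sval2 a p (W : 'M[C]_(p, m)) : a \is Num.real ->
    (forall u, (u <= W)%MS -> nsq (u *m X) <= a * nsq u) ->
  (\rank W <= #|[set i | (sval2 0 i <= a)%R]|)%N.
Proof.
move=> a_real Wa; set I := [set i | _].
rewrite -(leq_add2l #|~: I|) [X in (_ <= X)%N]addnC cardsC card_ord.
rewrite -(rank_singspace (~: I)) -mxrank_sum_cap.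
suff -> : \rank (singspace (~: I) :&: W)%MS = 0%N by rewrite addn0 rank_leq_col.
apply/eqP; rewrite mxrank_eq0; apply/eqP/row_matrixP => k; rewrite row0.
set u := row k _; have := row_sub k (singspace (~: I) :&: W)%MS.
rewrite -/u sub_capmx => /andP[uI uW]; have := Wa u uW.
rewrite nsq_sval2 -(nsq_svecC u) mulr_sumr -subr_ge0 -sumrB.
set y := u *m _ => ge0; apply/eqP; rewrite -nsq_eq0 -nsq_svecC -/y nsq_eq0.
have le0 i : 0 <= sval2 0 i * `|y 0 i| ^+ 2 - a * `|y 0 i| ^+ 2 ?= iff (y 0 i == 0).
  case: (boolP (i \in ~: I)) => [|iI]; last first.
    rewrite /y (singspace_coord _ uI iI) normr0 expr0n !mulr0 subrr eqxx.
    by split; rewrite ?lexx ?eqxx.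
  rewrite !inE -mulrBl -real_ltNge ?(ger0_real (sval2_ge0 _)) // => ia.
  split; first by rewrite mulr_ge0 ?exprn_ge0 // subr_ge0 ltW.
  by rewrite eq_sym mulf_eq0 subr_eq0 gt_eqF //= expf_eq0 normr_eq0.
have := ge0; rewrite -oppr_le0 -sumrN.
under eq_bigr => i _ do rewrite opprB.
move=> sle0; apply/eqP/rowP => i; rewrite [RHS]mxE; apply/eqP.
rewrite -(eq_leif (le0 i)) eq_sym.
have : \sum_i (sval2 0 i * `|y 0 i| ^+ 2 - a * `|y 0 i| ^+ 2) == 0.
  by rewrite eq_le sle0 sumr_ge0 // => l _; case: (le0 l).
rewrite psumr_eq0 => [/allP/(_ i (mem_index_enum _))/=|l _].
  by [].
by case: (le0 l).
Qed.

Lemma card_sval2_eq0 : #|[set i | sval2 0 i == 0]| = (m - \rank X)%N.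
Proof.
set I := [set i | _]; rewrite -mxrank_ker.
apply/eqP; rewrite eqn_leq; apply/andP; split; last first.
  have -> : I = [set i | (sval2 0 i <= 0)%R].
    by apply/setP => i; rewrite !inE eq_le sval2_ge0 andbT.
  apply: rank_le_small_sval2 => // u /sub_kermxP ->.
  by rewrite mul0r /nsq big1 // => j _; rewrite mxE normr0 expr0n.
rewrite -(rank_singspace I); apply: mxrankS; apply/sub_kermxP/row_matrixP => k.
rewrite row0 row_mul; apply/eqP; rewrite -nsq_eq0 row_rowsub -sval2_nsq.
by have := enum_valP k; rewrite inE.
Qed.

End OneMatrix.

Lemma normCK_det n (X : 'M[C]_n) : `|\det X| ^+ 2 = \prod_i sval2 X 0 i.
Proof.
have detC (Y : 'M[C]_n) : (\det Y)^* = \det (Y ^t*) by rewrite det_map_mx det_tr.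
rewrite normCK detC -det_mulmx gram_spectral !det_mulmx mulrAC -det_mulmx.
by rewrite svec_mulC det1 mul1r det_diag.
Qed.

(** The product of the squared singular values, at least [\rank W] of which are
    at most [a]. *)
Lemma det_le_contraction n (X : 'M[C]_n) (a c : C) p (W : 'M[C]_(p, n)) :
    0 <= a -> a <= c -> sqbounded c X ->
    (forall u, (u <= W)%MS -> nsq (u *m X) <= a * nsq u) ->
  `|\det X| ^+ 2 <= a ^+ \rank W * c ^+ (n - \rank W).
Proof.
move=> a0 ac Xc Wa; have c0 := le_trans a0 ac.
have := rank_le_small_sval2 (ger0_real a0) Wa; set I := [set i | _] => rI.
have In : (#|I| <= n)%N by rewrite -[X in (_ <= X)%N]card_ord max_card.
rewrite normCK_det (bigID (mem I)) /=.
apply: (@le_trans _ _ (a ^+ #|I| * c ^+ #|~: I|)).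
  apply: ler_pM; do ?by apply: prodr_ge0 => i _; exact: sval2_ge0.
    rewrite -prodr_const; apply: ler_prod => i.
    by rewrite inE sval2_ge0.
  rewrite -prodr_const [X in _ <= X](eq_bigl (fun i => ~~ mem I i)) => [|i]; last by rewrite inE.
  by apply: ler_prod => i _; rewrite sval2_ge0 sval2_le.
have -> : #|~: I| = (n - #|I|)%N.
  by apply/eqP; rewrite -(eqn_add2l #|I|) cardsC card_ord subnKC.
have -> : a ^+ #|I| = a ^+ (#|I| - \rank W) * a ^+ \rank W.
  by rewrite -exprD subnK.
have -> : c ^+ (n - \rank W) = c ^+ (#|I| - \rank W) * c ^+ (n - #|I|).
  by rewrite -exprD addnBAC // subnKC.
rewrite -mulrA [leRHS]mulrCA ler_wpM2r ?mulr_ge0 ?exprn_ge0 //.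
by rewrite lerXn2r.
Qed.

End SingularValues.

(** * Values of integral polynomials at eigenvalues *)

Section Integrality.
Local Open Scope sesquilinear_scope.
Context {C : numClosedFieldType}.

Lemma poly_horner_inj (p q : {poly C}) : (forall x, p.[x] = q.[x]) -> p = q.
Proof.
move=> pq; apply/eqP; rewrite -subr_eq0; apply/negPn/negP => pq0.
pose s : seq C := [seq i%:R | i <- iota 0 (size (p - q))].
have /(max_poly_roots pq0) : all (root (p - q)) s.
  by apply/allP => x _; rewrite rootE hornerD hornerN pq subrr.
rewrite size_map size_iota ltnn => /(_ _)/notF; apply.
by rewrite map_inj_uniq ?iota_uniq // => i j /eqP; rewrite eqr_nat => /eqP.
Qed.

(** Over an algebraically closed field [f] splits, and each factor contributes a
    value of the characteristic polynomial. *)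
Lemma det_horner_mx n (M : 'M[C]_n.+1) (s : seq C) (f : {poly C}) :
    char_poly M = \prod_(x <- s) ('X - x%:P) ->
  \det (horner_mx M f) = \prod_(x <- s) f.[x].
Proof.
move=> Ms.
have sz : size s = n.+1.
  by have := size_char_poly M; rewrite Ms size_prod_XsubC => -[].
have detM z : \det (M - z%:M) = \prod_(x <- s) (x - z).
  have := congr1 (horner_eval z) Ms.
  rewrite /char_poly -det_map_mx.
  have -> : map_mx (horner_eval z) (char_poly_mx M) = - (M - z%:M).
    apply/matrixP => i j; rewrite !mxE /horner_eval hornerD hornerN hornerMn.
    by rewrite hornerX hornerC opprB.
  rewrite -scaleN1r detZ /horner_eval horner_prod => /(congr1 ( *%R ((-1) ^+ n.+1))).
  rewrite mulrA -exprD addnn -mul2n exprM sqrrN expr1n expr1n mul1r => ->.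
  have -> : (-1) ^+ n.+1 = \prod_(x <- s) (-1) :> C.
    by rewrite big_const_seq count_predT iter_mulr_1 sz.
  rewrite -big_split /=; apply: eq_bigr => x _.
  by rewrite hornerXsubC mulN1r opprB.
have [->|f0] := eqVneq f 0.
  rewrite rmorph0 det0; case: s sz {Ms detM} => // x s _.
  by rewrite big_cons horner0 mul0r.
have [r ->] := closed_field_poly_normal f.
rewrite linearZ /= detZ rmorph_prod /=.
rewrite (big_morph _ (@det_mulmx _ _) (det1 _ _)).
under eq_bigr => z _ do rewrite rmorphB /= horner_mx_X horner_mx_C detM.
rewrite exchange_big /=.
under [RHS]eq_bigr => x _ do rewrite hornerZ horner_prod.
rewrite big_split /= big_const_seq count_predT iter_mulr_1 sz.
congr (_ * _); last first.
  apply: eq_bigr => x _; apply: eq_bigr => z _; by rewrite hornerXsubC.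
Qed.


Lemma char_poly_horner_mx n (M : 'M[C]_n.+1) (s : seq C) (f : {poly C}) :
    char_poly M = \prod_(x <- s) ('X - x%:P) ->
  char_poly (horner_mx M f) = \prod_(x <- s) ('X - f.[x]%:P).
Proof.
move=> Ms; apply: poly_horner_inj => y.
have -> : (\prod_(x <- s) ('X - (f.[x])%:P)).[y] = \prod_(x <- s) (y%:P - f).[x].
  rewrite horner_prod; apply: eq_bigr => x _.
  by rewrite hornerXsubC hornerD hornerN hornerC.
rewrite -(det_horner_mx _ Ms) rmorphB /= horner_mx_C -horner_evalE.
rewrite /char_poly -det_map_mx; congr (\det _); apply/matrixP => i j.
by rewrite !mxE /= /horner_eval hornerD hornerN hornerMn hornerX hornerC.
Qed.

Lemma norm_int_ge1 (k : int) : k != 0 -> 1 <= `|k%:~R : C|.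
Proof. by move=> k0; rewrite -intr_norm ler1z -gtz0_ge1 normr_gt0. Qed.

(** Up to sign, the product without its absolute values is the lowest nonzero coefficient of [p]. *)
Lemma prod_nz_ge1 (p : {poly int}) (s : seq C) :
    map_poly intr p = \prod_(x <- s) ('X - x%:P) ->
  1 <= \prod_(x <- s | x != 0) `|x|.
Proof.
move=> ps; set z := count (pred1 0) s.
have cz : (map_poly intr p : {poly C})`_z = \prod_(x <- s | x != 0) (- x).
  rewrite ps (bigID (pred1 0)) /=.
  rewrite (eq_bigr (fun=> 'X)) => [|x /eqP ->]; last by rewrite subr0.
  rewrite big_const_seq iter_mulr_1 mulrC coefMXn ltnn subnn -horner_coef0.
  by rewrite horner_prod; apply: eq_bigr => x _; rewrite hornerXsubC sub0r.
have: `|\prod_(x <- s | x != 0) (- x)| = \prod_(x <- s | x != 0) `|x|.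
  by rewrite normr_prod; apply: eq_bigr => x _; rewrite normrN.
rewrite -cz coef_map /= => <-; apply: norm_int_ge1.
rewrite -(intr_eq0 C) -(coef_map (intr : {rmorphism int -> C})) /= cz.
by rewrite prodf_seq_neq0; apply/allP => x _; apply/implyP; rewrite oppr_eq0.
Qed.

(** The values of an integral polynomial at the eigenvalues of an integral
    matrix are the eigenvalues of an integral matrix. *)
Lemma prod_horner_nz_ge1 n (M : 'M[int]_n) (s : seq C) (q : {poly int}) :
    char_poly (map_mx intr M) = \prod_(x <- s) ('X - x%:P) ->
  1 <= \prod_(x <- s | (map_poly intr q).[x] != 0) `|(map_poly intr q).[x]|.
Proof.
case: n M => [|n] M Ms.
  have := congr1 (fun p : {poly C} => size p) Ms.
  rewrite size_char_poly size_prod_XsubC => -[]; case: (s) => // _.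
  by rewrite big_nil.
have := @prod_nz_ge1 (char_poly (horner_mx M q))
  [seq (map_poly intr q).[x] | x <- s].
rewrite map_char_poly map_horner_mx (char_poly_horner_mx _ Ms) !big_map.
exact.
Qed.

Lemma prod_horner_root_nz_ge1 (p q : {poly int}) (s : seq C) :
    p \is monic -> map_poly intr p = \prod_(x <- s) ('X - x%:P) ->
  1 <= \prod_(x <- s | (map_poly intr q).[x] != 0) `|(map_poly intr q).[x]|.
Proof.
move=> pm ps.
apply: (@prod_horner_nz_ge1 _ (companionmx p)).
by rewrite -map_char_poly companionmxK.
Qed.

End Integrality.

(** * Small singular values: algebraic integers *)

Section Minors.
Local Open Scope sesquilinear_scope.
Context {C : numClosedFieldType}.

Lemma nsq_mul_rowsub1 r n (f : 'I_r -> 'I_n) (u : 'rV[C]_r) :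
  injective f -> nsq (u *m rowsub f 1%:M) = nsq u.
Proof.
move=> f_inj; rewrite !nsqE trmx_mul map_mxM mulmxA -[u *m _ *m _]mulmxA.
suff -> : rowsub f 1%:M *m (rowsub f 1%:M) ^t* = 1%:M :> 'M[C]_r by rewrite mulmx1.
rewrite trmx_mxsub map_mxsub trmx1 map_mx1 mul_rowsub_mx mul1mx.
by apply/matrixP => i j; rewrite !mxE (inj_eq f_inj).
Qed.

Lemma nsq_mul_colsub1 r n (g : 'I_r -> 'I_n) (u : 'rV[C]_n) :
  injective g -> nsq (u *m colsub g 1%:M) <= nsq u.
Proof.
move=> g_inj; rewrite mulmx_colsub mulmx1 /nsq.
rewrite [leRHS](bigID [in g @: [set: 'I_r]%SET]) /= big_imset /=; last by move=> i j _ _ /g_inj.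
rewrite -[leLHS]addr0; apply: lerD; last by apply: sumr_ge0 => i _; rewrite exprn_ge0.
rewrite [leRHS](eq_bigl predT) => [|i]; last by rewrite inE.
by apply: ler_sum => i _; rewrite mxE.
Qed.

Lemma mxsub_eq_mul r n (f g : 'I_r -> 'I_n) (B : 'M[C]_n) :
  mxsub f g B = rowsub f 1%:M *m B *m colsub g 1%:M.
Proof.
rewrite mulmx_colsub mulmx1 mul_rowsub_mx mul1mx.
by apply/matrixP => i j; rewrite !mxE.
Qed.


(** Keep a maximal free family of rows, then of columns. *)
Lemma exists_unit_minor n (B : 'M[C]_n) :
  exists f g : 'I_(\rank B) -> 'I_n,
    [/\ injective f, injective g & mxsub f g B \in unitmx].
Proof.
have full : row_full (rowsub (maxrankfun B) B)^T.
  by rewrite /row_full mxrank_tr; exact: maxrowsub_free.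
exists (maxrankfun B), (fullrankfun full).
split; [exact: maxrankfun_inj | exact: fullrankfun_inj |].
have := fullrowsub_unit full; rewrite -unitmx_tr; congr (_ \in unitmx).
by apply/matrixP => i j; rewrite !mxE.
Qed.

Lemma sqbounded_mxsub r n c (f g : 'I_r -> 'I_n) (B : 'M[C]_n) :
  injective f -> injective g -> sqbounded c B -> sqbounded c (mxsub f g B).
Proof.
move=> fI gI Bc u; rewrite mxsub_eq_mul !mulmxA.
apply: le_trans (nsq_mul_colsub1 _ gI) _.
by apply: le_trans (Bc _) _; rewrite nsq_mul_rowsub1.
Qed.

Lemma sqbounded_shift n K z (M : 'M[C]_n) :
  sqbounded K M -> sqbounded (2 * (`|z| ^+ 2 + K)) (z%:M - M).
Proof.
move=> MK u; rewrite mulmxBr mul_mx_scalar; apply: le_trans (nsqD_le _ _) _.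
rewrite -mulrA ler_wpM2l // mulrDl nsqZ lerD2l.
by rewrite -scaleN1r nsqZ normrN1 expr1n mul1r; exact: MK.
Qed.

Lemma nsq_singspace_le m n a (X : 'M[C]_(m, n)) (I : {set 'I_m}) u :
    (forall i, i \in I -> sval2 X 0 i <= a) -> (u <= singspace X I)%MS ->
  nsq (u *m X) <= a * nsq u.
Proof.
move=> Ia uI; rewrite nsq_sval2 -(nsq_svecC X u) /nsq mulr_sumr.
apply: ler_sum => i _; case: (boolP (i \in I)) => iI.
  by rewrite ler_wpM2r ?exprn_ge0 // Ia.
by rewrite (singspace_coord _ uI iI) normr0 expr0n !mulr0.
Qed.

(** A nonsingular minor of size [\rank B] sees all the small nonzero singular
    values of [B]: the vectors that [B] contracts form a space of dimension
    [\dim ker B + t], of which at least [t] dimensions are left among the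
    vectors supported on the rows of the minor. *)
Lemma minor_le_contraction n a c (B : 'M[C]_n) (f g : 'I_(\rank B) -> 'I_n)
    (t := #|[set i | (0 < sval2 B 0 i <= a)%R]|) :
    injective f -> injective g -> 0 <= a -> a <= 1 -> 1 <= c -> sqbounded c B ->
  `|\det (mxsub f g B)| ^+ 2 <= a ^+ t * c ^+ n.
Proof.
move=> fI gI a0 a1 c1 Bc.
pose I := [set i | sval2 B 0 i <= a].
have cI : #|I| = (t + (n - \rank B))%N.
  rewrite -card_sval2_eq0 -(cardsID [set i | sval2 B 0 i == 0] I) addnC.
  congr (_ + _)%N; apply: eq_card => i; rewrite !inE.
    by rewrite lt_def sval2_ge0 andbT.
  by case: eqP => [->|]; rewrite ?andbT ?andbF.
pose W := kermx (rowsub f 1%:M *m cokermx (singspace B I)).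
have Wrank : (t <= \rank W)%N.
  rewrite mxrank_ker.
  have := mxrankM_maxr (rowsub f 1%:M) (cokermx (singspace B I)).
  rewrite mxrank_coker rank_singspace.
  have := rank_leq_row B; have := max_card I; rewrite card_ord.
  by move: (\rank (_ *m _)) cI => x ->; lia.
have Wa u : (u <= W)%MS -> nsq (u *m mxsub f g B) <= a * nsq u.
  move=> /sub_kermxP; rewrite mulmxA => /eqP; rewrite -submxE => uI.
  rewrite mxsub_eq_mul !mulmxA; apply: le_trans (nsq_mul_colsub1 _ gI) _.
  rewrite -(nsq_mul_rowsub1 u fI).
  by apply: nsq_singspace_le uI => i; rewrite inE.
have := det_le_contraction a0 (le_trans a1 c1) (sqbounded_mxsub fI gI Bc) Wa.
move=> /le_trans; apply; apply: ler_pM; rewrite ?exprn_ge0 ?(le_trans a0) //.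
- exact: le_trans a1 c1.
- by rewrite ler_wiXn2l.
- rewrite ler_weXn2l //; exact: leq_trans (leq_subr _ _) (rank_leq_row _).
Qed.

(** The case of [det_le_contraction] where nothing is known to be contracted. *)
Lemma det_mxsub_le n r c (B : 'M[C]_n) (f g : 'I_r -> 'I_n) :
    injective f -> injective g -> (r <= n)%N -> 1 <= c -> sqbounded c B ->
  `|\det (mxsub f g B)| ^+ 2 <= c ^+ n.
Proof.
move=> fI gI rn c1 Bc.
have c0 : 0 <= c by apply: le_trans c1.
have W0 u : (u <= (0 : 'M[C]_r))%MS -> nsq (u *m mxsub f g B) <= 0 * nsq u.
  rewrite submx0 => /eqP ->; rewrite mul0mx mul0r /nsq big1 // => j _.
  by rewrite mxE normr0 expr0n.
have := det_le_contraction (lexx _) c0 (sqbounded_mxsub fI gI Bc) W0.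
rewrite mxrank0 expr0 mul1r subn0 => /le_trans; apply.
by rewrite ler_weXn2l.
Qed.

Definition minor_poly r n (f g : 'I_r -> 'I_n) (M : 'M[int]_n) : {poly int} :=
  \det (mxsub f g ('X%:M - map_mx polyC M)).

Lemma horner_minor_poly r n (f g : 'I_r -> 'I_n) (M : 'M[int]_n) (x : C) :
  (map_poly intr (minor_poly f g M)).[x] =
  \det (mxsub f g (x%:M - map_mx intr M)).
Proof.
rewrite /minor_poly -det_map_mx -[LHS]/(horner_eval x _) -det_map_mx.
congr (\det _); apply/matrixP => i j; rewrite !mxE /= rmorphB /= rmorphMn /=.
rewrite map_polyX map_polyC /horner_eval hornerD hornerN hornerMn.
by rewrite hornerX hornerC.
Qed.

(** For [lam] an algebraic integer, the chosen minor of [lam - M] is [q(lam)]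
    with [q] an integral polynomial; the conjugates of [q(lam)] are also minors,
    hence bounded, so the integrality of the norm keeps [q(lam)] away from 0. *)
Lemma algint_few_small_sval2 (p : {poly int}) (lam K : C) (L : nat) :
    p \is monic -> root (map_poly intr p) lam -> 0 <= K ->
  exists2 a : C, 0 < a <= 1 &
    forall n (M : 'M[int]_n), sqbounded K (map_mx intr M) ->
    (L * #|[set i | (0 < sval2 (lam%:M - map_mx intr M) 0 i <= a)%R]| <= n)%N.
Proof.
move=> pm plam K0.
have [s ps] := closed_field_poly_normal (map_poly intr p : {poly C}).
move: ps; rewrite lead_coef_map_id0 // ?intr_eq0; last by rewrite (monicP pm).
rewrite (monicP pm) scale1r => ps.
have lams : lam \in s by rewrite -root_prod_XsubC -ps.
pose c := 2 * (\sum_(x <- s) `|x| ^+ 2 + K) + 2.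
have S0 : 0 <= \sum_(x <- s) `|x| ^+ 2 by apply: sumr_ge0 => x _; rewrite exprn_ge0.
have c2 : 2 <= c by rewrite lerDr mulr_ge0 // addr_ge0.
have c1 : 1 <= c by apply: le_trans c2; rewrite ler1n.
have c_gt1 : 1 < c by apply: lt_le_trans c2; rewrite ltr1n.
have c0 : 0 < c by apply: lt_trans c_gt1.
have xc x n (M : 'M[C]_n) : x \in s -> sqbounded K M -> sqbounded c (x%:M - M).
  move=> xs MK u; apply: le_trans (sqbounded_shift x MK u) _.
  rewrite ler_wpM2r ?nsq_ge0 // -[leLHS]addr0 lerD // ler_wpM2l // lerD2r.
  by rewrite (big_rem x xs) /= lerDl sumr_ge0 // => y _; rewrite exprn_ge0.
pose E := c ^+ size s.
have E1 : 1 < E by rewrite exprn_egt1 //; case: (s) lams.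
have EL0 : 0 < E ^+ L by rewrite exprn_gt0 // exprn_gt0.
(* With this threshold, [t] small values imply [1 <= E ^ n / E ^ (L * t)]. *)
exists (E ^+ L)^-1.
  by rewrite invr_gt0 EL0 invf_le1 // exprn_ege1 // ltW.
move=> n M MK; set MC := map_mx intr M; set B := lam%:M - MC; set t := #|_|.
have [f [g [fI gI unitB]]] := exists_unit_minor B.
pose q := minor_poly f g M.
have qE x : (map_poly intr q).[x] = \det (mxsub f g (x%:M - MC)).
  exact: horner_minor_poly.
have qlam : (map_poly intr q).[lam] != 0 by rewrite qE -unitfE -unitmxE.
have := prod_horner_root_nz_ge1 q pm ps.
move=> /(exprn_ege1 2); rewrite -prodrXl.
rewrite (big_rem lam lams) /= qlam qE.
set r := rem lam s; set P := (\prod_(x <- r | _) _) => ge1.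
have Pc : P <= (c ^+ n) ^+ size r.
  rewrite /P big_mkcond /= -iter_mulr_1 -count_predT -big_const_seq.
  rewrite big_seq [leRHS]big_seq; apply: ler_prod => x /mem_rem xs.
  case: ifP => _; last by rewrite ler01 exprn_ege1.
  by rewrite exprn_ge0 // qE det_mxsub_le ?rank_leq_row //; exact: xc.
have := @minor_le_contraction n (E ^+ L)^-1 c B f g fI gI.
rewrite -/t invr_ge0 ltW // invf_le1 // exprn_ege1 ?(ltW E1) //.
move=> /(_ isT isT c1 (xc _ _ _ lams MK)) detB.
have : 1 <= (E ^+ L)^-1 ^+ t * E ^+ n.
  apply: le_trans ge1 _; apply: le_trans (ler_pM _ _ detB Pc) _.
  - by rewrite exprn_ge0.
  - by apply: prodr_ge0 => x _; rewrite exprn_ge0.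
  have szs : size s = (size r).+1 by rewrite (perm_size (perm_to_rem lams)).
  by rewrite -mulrA -exprS -szs (exprAC c n (size s)).
by rewrite exprVn -exprM ler_pdivlMl ?mulr1 ?ler_eXn2l // exprn_gt0 // (lt_trans _ E1).
Qed.

End Minors.

(** * Small singular values: other numbers *)

Section NearEigenvalues.
Local Open Scope sesquilinear_scope.
Context {C : numClosedFieldType}.

(** Roots of unity exist because ['X^n - 1] is separable and splits. *)
Lemma prim_root_exists n : (n > 0)%N -> exists z : C, n.-primitive_root z.
Proof.
move=> n_gt0; have [r Dp] := closed_field_poly_normal ('X^n - 1 : {poly C}).
rewrite (monicP _) ?monicXnsubC // scale1r in Dp.
have rn1: all n.-unity_root r by apply/allP=> z; rewrite -root_prod_XsubC -Dp.
have sz_r: (n < (size r).+1)%N.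
  by rewrite -(size_prod_XsubC r id) -Dp size_XnsubC.
have [|z] := hasP (has_prim_root n_gt0 rn1 _ sz_r); last by exists z.
by rewrite -separable_prod_XsubC -Dp separable_Xn_sub_1 // pnatr_eq0 -lt0n.
Qed.

Lemma sum_prim_root_exp k (w : C) i : k.-primitive_root w ->
  \sum_(j < k) w ^+ (j * i) = if (k %| i)%N then k%:R else 0.
Proof.
move=> pw; under eq_bigr => j _ do rewrite mulnC exprM.
case: ifP => ki.
  have -> : w ^+ i = 1 by apply/eqP; rewrite -(prim_order_dvd pw).
  by under eq_bigr => j _ do rewrite expr1n; rewrite sumr_const card_ord.
have wi : w ^+ i - 1 != 0 by rewrite subr_eq0 -(prim_order_dvd pw) ki.
apply: (mulfI wi); rewrite -subrX1 mulr0 -exprM mulnC exprM (prim_expr_order pw).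
by rewrite expr1n subrr.
Qed.

(** The mean of [x f(x)] over the roots of unity scaled by [rho] is the leading
    term, so [f] cannot be small at all of them. *)
Lemma monic_large_on_circle (f : {poly C}) r (rho : C) :
    f \is monic -> size f = r.+1 -> 0 < rho ->
  exists2 x, `|x| = rho & rho ^+ r <= `|f.[x]|.
Proof.
move=> fm fr rho0; have [w pw] := prim_root_exists (ltn0Sn r).
have nw : `|w| = 1.
  apply/eqP; rewrite -(@pexpr_eq1 _ _ r.+1) //.
  by rewrite -normrX (prim_expr_order pw) normr1.
pose x (j : 'I_r.+1) := rho * w ^+ j.
have nx j : `|x j| = rho by rewrite normrM normrX nw expr1n mulr1 gtr0_norm.
case: (boolP [exists j, rho ^+ r <= `|f.[x j]|]) => [/existsP[j fj]|].
  by exists (x j).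
rewrite negb_exists => /forallP small; exfalso.
have: \sum_j x j * f.[x j] = r.+1%:R * rho ^+ r.+1.
  under eq_bigr => j _ do rewrite horner_coef mulr_sumr fr.
  rewrite exchange_big /= big_ord_recr /= big1 ?add0r => [|i _].
    have -> : f`_r = 1 by rewrite -(monicP fm) lead_coefE fr.
    under eq_bigr => j _ do rewrite mul1r -exprS exprMn -exprM.
    by rewrite -mulr_sumr sum_prim_root_exp // dvdnn mulrC.
  under eq_bigr => j _ do rewrite mulrCA -exprS exprMn -exprM.
  by rewrite -!mulr_sumr sum_prim_root_exp // gtnNdvd ?mulr0 // ltnS.
move=> /(congr1 Num.norm) /eqP; rewrite lt_eqF //.
apply: le_lt_trans (ler_norm_sum _ _ _) _.
have -> : `|r.+1%:R * rho ^+ r.+1| = \sum_(j < r.+1) rho ^+ r.+1.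
  rewrite sumr_const card_ord mulr_natl ger0_norm //.
  by rewrite mulrn_wge0 // exprn_ge0 // ltW.
apply: ltr_sum => [|j _]; first by apply/hasP; exists ord0; rewrite ?mem_index_enum.
rewrite normrM nx exprS ltr_pM2l //.
by have := small j; rewrite -real_ltNge ?rpredX ?normr_real // ger0_real // ltW.
Qed.

Lemma poly_bounded (p : {poly C}) (k : C) : 0 <= k ->
  exists2 c, 0 < c & forall z, `|z| <= k -> `|p.[z]| <= c.
Proof.
move=> k0; exists (1 + \sum_(i < size p) `|p`_i| * k ^+ i) => [|z zk].
  by rewrite ltr_pwDl // sumr_ge0 // => i _; rewrite mulr_ge0 ?exprn_ge0.
rewrite horner_coef; apply: le_trans (ler_norm_sum _ _ _) _.
rewrite -[leLHS]add0r lerD //; apply: ler_sum => i _.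
by rewrite normrM ler_wpM2l // normrX lerXn2r ?nnegrE.
Qed.

Lemma poly_lipschitz_at (p : {poly C}) (lam k : C) : 0 <= k ->
  exists2 c, 0 < c & forall z, `|z| <= k -> `|p.[z] - p.[lam]| <= c * `|z - lam|.
Proof.
move=> k0; have /factor_theorem[q pq] : root (p - p.[lam]%:P) lam.
  by rewrite rootE hornerD hornerN hornerC subrr.
have [c c0 qc] := poly_bounded q k0; exists c => // z zk.
have -> : p.[z] - p.[lam] = q.[z] * (z - lam).
  have := congr1 (horner_eval z) pq.
  by rewrite /horner_eval hornerD hornerN hornerC hornerM hornerXsubC.
by rewrite normrM ler_wpM2r ?qc.
Qed.

Lemma pos_below2 (u v : C) : 0 < u -> 0 < v ->
  exists d, [/\ 0 < d, d < u & d < v].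
Proof.
move=> u0 v0; exists (u * v / (u + v)).
have uv := addr_gt0 u0 v0.
split; first by rewrite divr_gt0 ?mulr_gt0.
  by rewrite ltr_pdivrMr // ltr_pM2l // ltrDr.
by rewrite ltr_pdivrMr // mulrC ltr_pM2l // ltrDl.
Qed.

Lemma poly_neq0_near (p : {poly C}) (lam k : C) : p != 0 -> 0 <= k ->
  exists2 d, 0 < d &
    forall z, `|z| <= k -> `|z - lam| < d -> z != lam -> p.[z] != 0.
Proof.
move=> p0 k0; have [e [q]] := multiplicity_XsubC p lam; rewrite p0 /= => qlam ->.
have [c c0 qc] := poly_lipschitz_at q lam k0; exists (`|q.[lam]| / c).
  by rewrite divr_gt0 ?normr_gt0.
move=> z zk; rewrite ltr_pdivlMr // => zd zlam.
rewrite hornerM horner_exp hornerXsubC mulf_eq0 negb_or expf_eq0 subr_eq0.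
rewrite (negbTE zlam) andbF andbT; apply: contraTneq zd => qz.
have := qc z zk; rewrite qz sub0r normrN mulrC => H.
by rewrite -real_leNgt ?normr_real // rpredM ?normr_real // gtr0_real.
Qed.

Lemma eigenvalue_sqbounded n K (M : 'M[C]_n) x :
  sqbounded K M -> root (char_poly M) x -> `|x| ^+ 2 <= K.
Proof.
move=> MK; rewrite -eigenvalue_root_char => /eigenvalueP[v vM v0].
have := MK v; rewrite vM nsqZ ler_pM2r // lt_def nsq_ge0 andbT.
by rewrite nsq_eq0.
Qed.


Lemma prod_le_expr_count (s : seq C) (P : pred C) (F : C -> C) (a b : C) :
    (forall x, x \in s -> P x -> 0 <= F x <= a) ->
    (forall x, x \in s -> ~~ P x -> 0 <= F x <= b) ->
  \prod_(x <- s) F x <= a ^+ count P s * b ^+ count (predC P) s.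
Proof.
move=> Fa Fb; rewrite (bigID P) /= -!iter_mulr_1 -!big_const_seq /=.
rewrite big_seq_cond [X in _ * X <= _]big_seq_cond.
rewrite [X in _ <= X * _]big_seq_cond [X in _ <= _ * X]big_seq_cond.
apply: ler_pM.
- by apply: prodr_ge0 => x /andP[xs Px]; have /andP[] := Fa x xs Px.
- by apply: prodr_ge0 => x /andP[xs Px]; have /andP[] := Fb x xs Px.
- by apply: ler_prod => x /andP[xs Px]; exact: Fa.
- by apply: ler_prod => x /andP[xs Px]; exact: Fb.
Qed.

(** Meant for [Q] tiny on [P] compared with its size elsewhere: the product of
    the values of [Q] over all the eigenvalues, at least 1 once zeros are
    discarded, leaves room for few eigenvalues in [P]. *)
Lemma few_near_eigenvalues n (M : 'M[int]_n) (s : seq C) (Q : {poly int})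
    (c : C) (L : nat) (P : pred C) :
    char_poly (map_mx intr M) = \prod_(x <- s) ('X - x%:P) -> 1 < c ->
    (forall x, x \in s -> `|(map_poly intr Q).[x]| <= c) ->
    (forall x, x \in s -> P x -> (map_poly intr Q).[x] != 0 /\
                                `|(map_poly intr Q).[x]| <= (c ^+ L)^-1) ->
  (L * count P s <= size s)%N.
Proof.
move=> Ms c1 Qc QP; have c0 : 0 < c by apply: lt_trans c1.
have := prod_horner_nz_ge1 Q Ms; rewrite big_mkcond /= => ge1.
have := @prod_le_expr_count s P
  (fun x => if (map_poly intr Q).[x] != 0 then `|(map_poly intr Q).[x]| else 1)
  (c ^+ L)^-1 c.
move=> /(_ _ _)/(le_trans ge1) H.
have : 1 <= (c ^+ L)^-1 ^+ count P s * c ^+ count (predC P) s.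
  apply: H => x xs Px; first by have [-> ->] := QP x xs Px; rewrite normr_ge0.
  by case: ifP => _; rewrite ?normr_ge0 ?Qc // ler01 ltW.
rewrite exprVn -exprM ler_pdivlMl ?exprn_gt0 // mulr1 ler_eXn2l // => /leq_trans.
by apply; exact: count_size.
Qed.

Lemma det_shift n (M : 'M[C]_n) z : \det (z%:M - M) = (char_poly M).[z].
Proof.
rewrite -horner_evalE /char_poly -det_map_mx; congr (\det _).
apply/matrixP => i j.
by rewrite !mxE /= /horner_eval hornerD hornerN hornerMn hornerX hornerC.
Qed.

(** As [lam] may be arbitrarily near an eigenvalue, [det (lam - M)] has no lower
    bound; it is replaced by [det (lam' - M)] for a [lam'] at a distance [rho]
    from [lam]. If [r] eigenvalues are near [lam], the choice of [lam'] makes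
    this determinant at least about [rho ^ r], whereas the [#|I|] contracted
    dimensions make it at most about [rho ^ #|I|]. As [rho] is much smaller
    than the other constants, [#|I|] can exceed [r] by little. *)
Lemma nonalgint_few_small_sval2 (lam K : C) (L : nat) :
    (forall p : {poly int}, p \is monic -> ~~ root (map_poly intr p) lam) ->
    0 <= K -> (0 < L)%N ->
    (exists (Q : {poly int}) (c : C), [/\ Q != 0, 1 < c,
       forall z, `|z| <= 1 + K -> `|(map_poly intr Q).[z]| <= c &
       2 * `|(map_poly intr Q).[lam]| * c ^+ L <= 1]) ->
  exists2 a : C, 0 < a <= 1 &
    forall n (M : 'M[int]_n), sqbounded K (map_mx intr M) ->
    (L * #|[set i | (sval2 (lam%:M - map_mx intr M) 0 i <= a)%R]| <= 2 * n)%N.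
Proof.
move=> nonint K0 L0 [Q [c [Q0 c1 Qc Qlam]]]; set QC := map_poly intr Q in Qc Qlam.
have c0 : 0 < c by apply: lt_trans c1.
have cL0 : 0 < c ^+ L by rewrite exprn_gt0.
have K1 : 0 <= 1 + K by rewrite addr_ge0.
have QC0 : QC != 0 by rewrite map_poly_eq0_id0 // intr_eq0 lead_coef_eq0.
have [d1 d1_0 Qd1] := poly_neq0_near lam QC0 K1.
have [c2 c2_0 Qc2] := poly_lipschitz_at QC lam K1.
have d2_0 : 0 < (2 * c ^+ L)^-1 / c2 by rewrite divr_gt0 // invr_gt0 mulr_gt0.
have [d3 [d3_0 d31 d32]] := pos_below2 d1_0 d2_0.
have [d [d0 dd3 d_1]] := pos_below2 d3_0 (ltr01 : 0 < 1 :> C).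
pose nearby := [pred x | `|x - lam| < d].
have Qnear x : `|x| <= 1 + K -> x != lam -> nearby x ->
    QC.[x] != 0 /\ `|QC.[x]| <= (c ^+ L)^-1.
  move=> xK xlam /= xd; split.
    by apply: Qd1 => //; apply: lt_trans d31; apply: lt_trans dd3.
  rewrite -[QC.[x]](subrK QC.[lam]); apply: le_trans (ler_normD _ _) _.
  have -> : (c ^+ L)^-1 = (2 * c ^+ L)^-1 + (2 * c ^+ L)^-1.
    by field; rewrite gt_eqF.
  apply: lerD.
    apply: le_trans (Qc2 x xK) _; rewrite mulrC -ler_pdivlMr //.
    by apply: ltW; apply: lt_trans d32; apply: lt_trans dd3.
  by rewrite -[leRHS]mul1r ler_pdivlMr ?mulr_gt0 // mulrCA mulrA.
pose c3 := 2 * ((`|lam| + 1) ^+ 2 + K) + 4.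
have c3_4 : 4 <= c3.
  by rewrite lerDr mulr_ge0 // addr_ge0 // exprn_ge0 // addr_ge0.
have c3_1 : 1 <= c3 by apply: le_trans c3_4; rewrite ler1n.
pose E := 16 * c3 / d ^+ 2.
have E1 : 1 < E.
  rewrite ltr_pdivlMr ?exprn_gt0 // mul1r.
  apply: (@lt_le_trans _ _ 1); first by rewrite exprn_ilt1 // ltW.
  by rewrite -[leLHS]mul1r ler_pM // ler1n.
have E0 : 0 < E by apply: lt_trans E1.
(* [E] absorbs the constants: [(4 * c3) ^ n <= E ^ n * (d / 2) ^ (2 * n)]. *)
pose rho := (E ^+ L)^-1.
have rho0 : 0 < rho by rewrite invr_gt0 exprn_gt0.
have rho_d : rho <= d / 2.
  apply: (@le_trans _ _ E^-1).
    by rewrite lef_pV2 ?posrE ?exprn_gt0 // -(prednK L0) exprS ler_peMr ?exprn_ege1 // ltW.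
  rewrite invf_div ler_pdivrMr ?mulr_gt0 ?(lt_le_trans _ c3_1) //.
  rewrite expr2 -!mulrA ler_wpM2l ?(ltW d0) //.
  apply: (@le_trans _ _ 1); first by rewrite ltW.
  have -> : 2^-1 * (16 * c3) = 8 * c3 by field.
  by rewrite -[leLHS]mul1r ler_pM // ler1n.
have rho1 : rho <= 1.
  by apply: le_trans rho_d _; rewrite ler_pdivrMr // mul1r ltW // (lt_trans d_1) // ltr1n.
exists (rho ^+ 2); first by rewrite exprn_gt0 // exprn_ile1 // ltW.
move=> n M MK; set MC := map_mx intr M; set B := lam%:M - MC.
set I := [set i | _].
have [s Ms] := closed_field_poly_normal (char_poly MC).
rewrite (monicP (char_poly_monic _)) scale1r in Ms.
have szs : size s = n.
  by have := size_char_poly MC; rewrite Ms size_prod_XsubC => -[].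
have sK x : x \in s -> `|x| <= 1 + K.
  rewrite -root_prod_XsubC -Ms => /(eigenvalue_sqbounded MK) xK.
  apply: (@le_trans _ _ (1 + `|x| ^+ 2)); last by rewrite lerD2l.
  rewrite -subr_ge0.
  have -> : 1 + `|x| ^+ 2 - `|x| = (`|x| - 2^-1) ^+ 2 + 3 / 4 by field.
  have x_real : `|x| - 2^-1 \is Num.real.
    by apply: rpredB; rewrite ?normr_real // ger0_real // invr_ge0.
  by apply: addr_ge0; rewrite ?divr_ge0 // real_exprn_even_ge0.
have slam x : x \in s -> x != lam.
  apply: contraTneq => ->; rewrite -root_prod_XsubC -Ms -map_char_poly.
  by rewrite nonint // char_poly_monic.
have Lr : (L * count nearby s <= n)%N.
  rewrite -szs; apply: (few_near_eigenvalues Ms c1 (Q := Q)) => x xs.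
    exact/Qc/sK.
  by apply: Qnear; [exact: sK | exact: slam].
set r := count nearby s in Lr.
pose f : {poly C} := \prod_(y <- [seq x - lam | x <- seq.filter nearby s]) ('X - y%:P).
have [||x nx fx] := @monic_large_on_circle f r rho _ _ rho0.
- by rewrite monic_prod_XsubC.
- by rewrite size_prod_XsubC size_map size_filter.
pose lam' := lam + x.
have det_ge : rho ^+ r * (d / 2) ^+ n <= `|\det (lam'%:M - MC)|.
  rewrite det_shift Ms horner_prod normr_prod (bigID nearby) /=.
  have d20 : 0 <= d / 2 by rewrite divr_ge0 // ltW.
  have r0 : 0 <= rho by rewrite ltW.
  apply: ler_pM; rewrite ?exprn_ge0 //.
    apply: le_trans fx _; rewrite horner_prod big_map big_filter normr_prod.
    apply: ler_prod => y _; rewrite normr_ge0 !hornerXsubC /lam'.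
    have -> : x - (y - lam) = lam + x - y by ring.
    exact: lexx.
  apply: (@le_trans _ _ ((d / 2) ^+ count (predC nearby) s)).
    rewrite ler_wiXn2l // -?szs ?count_size //.
    by rewrite ler_pdivrMr // mul1r ltW // (lt_trans d_1) // ltr1n.
  rewrite -iter_mulr_1 -big_const_seq; apply: ler_prod => y /= yfar.
  rewrite d20 hornerXsubC /lam' -real_leNgt ?normr_real ?gtr0_real // in yfar *.
  have -> : lam + x - y = - (y - lam) - - x by ring.
  apply: le_trans (lerB_dist _ _); rewrite !normrN nx lerBrDr.
  apply: le_trans (_ : d / 2 + d / 2 <= _); first by rewrite lerD2l.
  by have -> : d / 2 + d / 2 = d by field.
have contr u : (u <= singspace B I)%MS ->
    nsq (u *m (lam'%:M - MC)) <= (4 * rho ^+ 2) * nsq u.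
  move=> uI.
  have -> : u *m (lam'%:M - MC) = u *m B + x *: u.
    by rewrite mulmxBr mul_mx_scalar /B mulmxBr mul_mx_scalar /lam' scalerDl addrAC.
  apply: le_trans (nsqD_le _ _) _.
  have -> : 4 * rho ^+ 2 * nsq u = 2 * (rho ^+ 2 * nsq u + rho ^+ 2 * nsq u) by ring.
  rewrite ler_wpM2l // lerD //; last by rewrite nsqZ nx.
  by apply: nsq_singspace_le uI => i; rewrite inE.
have bd : sqbounded c3 (lam'%:M - MC).
  move=> u; apply: le_trans (sqbounded_shift lam' MK u) _.
  rewrite ler_wpM2r ?nsq_ge0 // -[leLHS]addr0 lerD // ler_wpM2l // lerD2r.
  rewrite lerXn2r ?nnegrE ?addr_ge0 //; apply: le_trans (ler_normD _ _) _.
  by rewrite lerD2l nx.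
have rho2 : 0 <= 4 * rho ^+ 2 by rewrite mulr_ge0 // exprn_ge0 // ltW.
have rho2c3 : 4 * rho ^+ 2 <= c3.
  apply: le_trans c3_4; rewrite -[leRHS]mulr1 ler_wpM2l // exprn_ile1 // ltW //.
have := det_le_contraction rho2 rho2c3 bd contr; rewrite rank_singspace => det_le.
have In : (#|I| <= n)%N by rewrite -[X in (_ <= X)%N]card_ord max_card.
have r0 : 0 <= rho by rewrite ltW.
have main : rho ^+ (2 * r) <= rho ^+ (2 * #|I|) * E ^+ n.
  have dn0 : 0 < (d / 2) ^+ (2 * n) by rewrite exprn_gt0 // divr_gt0.
  rewrite -(ler_pM2r dn0).
  apply: (@le_trans _ _ (`|\det (lam'%:M - MC)| ^+ 2)).
    rewrite mulnC exprM mulnC exprM -exprMn lerXn2r ?nnegrE //.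
    by rewrite mulr_ge0 ?exprn_ge0 // divr_ge0 // ltW.
  apply: le_trans det_le _.
  have -> : rho ^+ (2 * #|I|) * E ^+ n * (d / 2) ^+ (2 * n) =
      (4 ^+ n * (rho ^+ 2) ^+ #|I|) * c3 ^+ n.
    have ed : E ^+ n * (d / 2) ^+ (2 * n) = 4 ^+ n * c3 ^+ n.
      rewrite exprM -!exprMn; congr (_ ^+ n).
      by rewrite /E; field; rewrite gt_eqF.
    by rewrite -mulrA ed exprM mulrA [_ * 4 ^+ n]mulrC.
  rewrite exprMn; apply: ler_pM.
  - by rewrite mulr_ge0 ?exprn_ge0.
  - by rewrite exprn_ge0 // (le_trans _ c3_1).
  - by rewrite ler_wpM2r ?exprn_ge0 // ler_weXn2l // ler1n.
  - by rewrite ler_weXn2l // leq_subr.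
have : (L * (2 * #|I|) <= n + L * (2 * r))%N.
  rewrite -(ler_eXn2l E1) exprD.
  have e0 k : 0 < E ^+ k by rewrite exprn_gt0.
  move: main; rewrite /rho !exprVn -!exprM.
  by rewrite ler_pdivlMl // ler_pdivrMr.
rewrite !(mulnCA L) => H; move: H Lr; clear.
move: (L * r)%N (L * #|I|)%N => a b; lia.
Qed.

End NearEigenvalues.

(** * Integral polynomials with a small value *)

Section Dirichlet.
Context {R : realType}.
Local Notation C := R[i].

Lemma normc_Re_le (z : C) : `|complex.Re z|%:C%C <= `|z|.
Proof. by rewrite normc_def lecR -sqrtr_sqr ler_wsqrtr // lerDl sqr_ge0. Qed.

Lemma normc_Im_le (z : C) : `|complex.Im z|%:C%C <= `|z|.
Proof. by rewrite normc_def lecR -sqrtr_sqr ler_wsqrtr // lerDr sqr_ge0. Qed.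

Lemma normc_le_ReIm (z : C) : `|z| <= (`|complex.Re z| + `|complex.Im z|)%:C%C.
Proof.
rewrite normc_def lecR -[leRHS]ger0_norm ?addr_ge0 // -sqrtr_sqr ler_wsqrtr //.
rewrite sqrrD !real_normK ?num_real // lerD2r lerDl.
by rewrite mulrn_wge0 // mulr_ge0.
Qed.

Lemma same_truncn_dist (x y : R) : 0 <= x -> 0 <= y ->
  Num.truncn x = Num.truncn y -> `|x - y| <= 1.
Proof.
move=> x0 y0 xy; have /andP[] := truncn_itv x0; have /andP[] := truncn_itv y0.
rewrite xy -natr1; move: (Num.truncn y)%:R => t ? ? ? ?.
by rewrite ler_norml; apply/andP; split; lra.
Qed.

(** The polynomials of degree less than [2 e + 2] with coefficients below [h]
    are more numerous than the boxes of side [2 h S / h ^ e] needed to cover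
    their values at [lam]. *)
Lemma integer_poly_small_value (lam : C) (k : R) (e h : nat)
    (S := \sum_(j < e.*2.+2) k ^+ j) :
    `|lam| <= k%:C%C -> 0 <= k -> (2 < h)%N ->
  exists Q : {poly int}, [/\ Q != 0,
    forall z : C, `|z| <= k%:C%C -> `|(map_poly intr Q).[z]| <= (h%:R * S)%:C%C &
    `|(map_poly intr Q).[lam]| <= (4 * h%:R * S / h%:R ^+ e)%:C%C].
Proof.
move=> lamk k0 h2; set D := e.*2.+2 in S *.
have h0 : (0 < h)%N by apply: leq_trans h2.
have hR : 0 < h%:R :> R by rewrite ltr0n.
have S1 : 1 <= S.
  rewrite /S big_ord_recl expr0 lerDl sumr_ge0 // => j _; exact: exprn_ge0.
have S0 : 0 < S by apply: lt_le_trans S1.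
pose P (c : 'I_D -> int) : {poly int} := \sum_j c j *: 'X^j.
have PE c (z : C) : (map_poly intr (P c)).[z] = \sum_j (c j)%:~R * z ^+ j.
  rewrite /P rmorph_sum horner_sum; apply: eq_bigr => j _.
  by rewrite /= map_polyZ map_polyXn hornerZ hornerXn.
have Pbound (c : 'I_D -> int) (z : C) : (forall j, `|c j| <= h%:Z) -> `|z| <= k%:C%C ->
    `|\sum_j (c j)%:~R * z ^+ j| <= (h%:R * S)%:C%C.
  move=> ch zk; rewrite rmorphM rmorph_nat /S rmorph_sum /= mulr_sumr.
  apply: le_trans (ler_norm_sum _ _ _) _; apply: ler_sum => j _.
  rewrite normrM rmorphXn /= normrX ler_pM ?exprn_ge0 //.
    by rewrite -intr_norm -[h%:R]/(h%:Z%:~R) ler_int.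
  by rewrite lerXn2r ?nnegrE // ler0c.
pose v (f : {ffun 'I_D -> 'I_h}) : C := \sum_j (f j)%:Z%:~R * lam ^+ j.
have vh f : `|v f| <= (h%:R * S)%:C%C.
  by apply: (Pbound (fun j => (f j)%:Z)) => // j; rewrite ger0_norm // lez_nat ltnW.
set m := (h ^ e)%N; have hS0 : 0 < h%:R * S by rewrite mulr_gt0.
have m0 : 0 < m%:R :> R by rewrite ltr0n expn_gt0 h0.
pose xi (t : R) := (t + h%:R * S) / (2 * (h%:R * S)) * m%:R.
have xi0 t : `|t| <= h%:R * S -> 0 <= xi t.
  rewrite ler_norml => /andP[t1 _]; rewrite mulr_ge0 ?divr_ge0 ?(ltW hS0) ?(ltW m0) //.
    by rewrite -lerBlDr sub0r.
  by rewrite mulr_ge0 // ltW.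
have xim t : `|t| <= h%:R * S -> (Num.truncn (xi t) < m.+1)%N.
  move=> th; rewrite truncn_lt_nat ?xi0 //; apply: (@le_lt_trans _ _ m%:R).
    rewrite -[leRHS]mul1r ler_wpM2r // ler_pdivrMr ?mulr_gt0 // mul1r.
    by move: th; rewrite ler_norml => /andP[_ t2]; rewrite (mulr_natl _ 2) mulr2n lerD2r.
  by rewrite ltr_nat.
have xi_dist t t' : `|t| <= h%:R * S -> `|t'| <= h%:R * S ->
    Num.truncn (xi t) = Num.truncn (xi t') ->
    `|t - t'| <= 2 * (h%:R * S) / m%:R.
  move=> th th' /(same_truncn_dist (xi0 _ th) (xi0 _ th')).
  have -> : xi t - xi t' = (t - t') * (m%:R / (2 * (h%:R * S))).
    by rewrite /xi; field; rewrite !gt_eqF.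
  rewrite normrM [ `|_ / _| ]gtr0_norm ?divr_gt0 ?mulr_gt0 //.
  by rewrite -ler_pdivlMr ?divr_gt0 ?mulr_gt0 // mul1r invf_div.
have Re_h f : `|complex.Re (v f)| <= h%:R * S.
  by rewrite -lecR; apply: le_trans (normc_Re_le _) (vh f).
have Im_h f : `|complex.Im (v f)| <= h%:R * S.
  by rewrite -lecR; apply: le_trans (normc_Im_le _) (vh f).
pose F (f : {ffun 'I_D -> 'I_h}) : 'I_m.+1 * 'I_m.+1 :=
  (Ordinal (xim _ (Re_h f)), Ordinal (xim _ (Im_h f))).
have : ~~ injectiveb F.
  apply/negP => /injectiveP/leq_card; rewrite card_prod !card_ord.
  rewrite card_ffun !card_ord; apply/negP; rewrite -ltnNge.
  have m1 : (0 < m)%N by rewrite expn_gt0 h0.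
  apply: (@leq_ltn_trans ((2 * m) * (2 * m))).
    by rewrite leq_mul // mul2n -addnn -addn1 leq_add2l.
  have -> : (h ^ D = (h * m) * (h * m))%N.
    by rewrite -!expnS -expnD addSn addnS addnn.
  by rewrite ltn_mul // ltn_mul2r m1 h2.
case/injectivePn => f [g fg [Re_fg Im_fg]].
pose c j : int := (f j)%:Z - (g j)%:Z.
have cv : \sum_j (c j)%:~R * lam ^+ j = v f - v g.
  by rewrite /v -sumrB; apply: eq_bigr => j _; rewrite intrB mulrBl.
exists (P c); split=> [|z zk|].
- apply: contraNneq fg => Pc; apply/eqP/ffunP => j; apply/val_inj/eqP.
  have := congr1 (fun p : {poly int} => p`_j) Pc.
  rewrite /P coef_sum (bigD1 j) //= big1 => [|i ij].
    by rewrite coefZ coefXn eqxx mulr1 addr0 coef0 => /eqP; rewrite subr_eq0.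
  by rewrite coefZ coefXn (inj_eq val_inj) eq_sym (negbTE ij) mulr0.
- rewrite PE; apply: Pbound => // j; rewrite /c ler_norml.
  have := ltn_ord (f j); have := ltn_ord (g j).
  move: (nat_of_ord (f j)) (nat_of_ord (g j)); clear => a b bh ah.
  by apply/andP; split; lia.
rewrite PE cv; apply: le_trans (normc_le_ReIm _) _; rewrite lecR !raddfB /=.
have -> : 4 * h%:R * S / h%:R ^+ e =
    2 * (h%:R * S) / m%:R + 2 * (h%:R * S) / m%:R.
  by rewrite /m natrX; field; rewrite gt_eqF // exprn_gt0.
by apply: lerD; apply: xi_dist.
Qed.

Lemma dirichlet_polynomial (lam K : C) (L : nat) : 0 <= K ->
  exists (Q : {poly int}) (c : C), [/\ Q != 0, 1 < c,
    forall z, `|z| <= 1 + K -> `|(map_poly intr Q).[z]| <= c &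
    2 * `|(map_poly intr Q).[lam]| * c ^+ L <= 1].
Proof.
move=> K0.
have [k kE] : exists k : R, k%:C%C = 1 + K + `|lam|.
  exists (complex.Re (1 + K + `|lam|)); apply: RRe_real.
  by rewrite ger0_real // !addr_ge0.
have k0 : 0 <= k by rewrite -ler0c kE !addr_ge0.
pose S : R := \sum_(j < L.+2.*2.+2) k ^+ j.
have S1 : 1 <= S.
  by rewrite /S big_ord_recl expr0 lerDl sumr_ge0 // => j _; exact: exprn_ge0.
(* With [e = L + 2] the bound to establish becomes [8 * S ^ (L + 1) / h <= 1]. *)
pose h := (Num.truncn (8 * S ^+ L.+1)).+3.
have hS : 8 * S ^+ L.+1 <= h%:R.
  apply: ltW; apply: lt_trans (truncnS_gt _) _; by rewrite ltr_nat.
have [|//||Q [Q0 Qk Qlam]] := @integer_poly_small_value lam k L.+2 h.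
- by rewrite kE lerDr addr_ge0.
- by [].
have h0 : 0 < h%:R :> R by rewrite ltr0n.
exists Q, (h%:R * S)%:C%C; split=> //.
- rewrite -[1]/(1%:C%C) ltcR; apply: (@lt_le_trans _ _ h%:R); first by rewrite ltr1n.
  by rewrite ler_peMr // ltW.
- by move=> z zK; apply: Qk; apply: le_trans zK _; rewrite kE lerDl.
have S0 : 0 < S by apply: lt_le_trans S1.
have CE (y X : R) : 2 * y%:C%C * X%:C%C ^+ L = (2 * y * X ^+ L)%:C%C.
  by rewrite !rmorphM rmorphXn rmorph_nat.
apply: le_trans (_ : (2 * (4 * h%:R * S / h%:R ^+ L.+2) * (h%:R * S) ^+ L)%:C%C <= _).
  rewrite -CE ler_wpM2r ?ler_wpM2l // exprn_ge0 // ler0c mulr_ge0 // ltW //.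
rewrite -[leRHS]/(1%:C%C) lecR.
have -> : 2 * (4 * h%:R * S / h%:R ^+ L.+2) * (h%:R * S) ^+ L = (8 * S ^+ L.+1) / h%:R.
  by rewrite exprMn !exprS; field; rewrite !gt_eqF // exprn_gt0.
by rewrite ler_pdivrMr // mul1r.
Qed.

End Dirichlet.

(** * Small singular values and traces of powers *)

Lemma few_small_sval2 (R : realType) (lam K : R[i]) (L : nat) :
    0 <= K -> (0 < L)%N ->
  exists2 a : R[i], 0 < a <= 1 &
    forall n (M : 'M[int]_n), sqbounded K (map_mx intr M) ->
    (L * #|[set i | (0 < sval2 (lam%:M - map_mx intr M) 0 i <= a)%R]| <= 2 * n)%N.
Proof.
move=> K0 L0.
have [[p [pm plam]]|noint] := pselect (exists p : {poly int},
    p \is monic /\ root (map_poly intr p) lam).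
  have [a a01 aP] := algint_few_small_sval2 L pm plam K0; exists a => // n M MK.
  by apply: leq_trans (aP n M MK) _; rewrite leq_pmull.
have lam_nonint (p : {poly int}) : p \is monic -> ~~ root (map_poly intr p) lam.
  by move=> pm; apply/negP => plam; apply: noint; exists p.
have [a a01 aP] :=
  nonalgint_few_small_sval2 lam_nonint K0 L0 (dirichlet_polynomial lam L K0).
exists a => // n M MK; apply: leq_trans (aP n M MK).
rewrite leq_mul2l; apply/orP; right; apply: subset_leq_card; apply/fintype.subsetP => i.
by rewrite !inE => /andP[].
Qed.

Section TracePowers.
Local Open Scope sesquilinear_scope.
Context {C : numClosedFieldType}.
Variables (n : nat) (X : 'M[C]_n) (c : C).
Hypotheses (c_gt0 : 0 < c) (Xc : sqbounded c X).

Let T := 1%:M - c^-1 *: (X *m X ^t*).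
Let w i := 1 - sval2 X 0 i / c.

Lemma iter_gram_spectral k :
  iter k (mulmx T) 1%:M = (svec X) ^t* *m diag_mx (\row_i w i ^+ k) *m svec X.
Proof.
elim: k => [|k IHk] /=.
  have -> : diag_mx (\row_i w i ^+ 0) = 1%:M :> 'M[C]_n.
    by apply/matrixP => i j; rewrite !mxE expr0.
  by rewrite mulmx1 svec_mulC.
rewrite IHk; have -> : T = (svec X) ^t* *m diag_mx (\row_i w i) *m svec X.
  have -> : diag_mx (\row_i w i) = 1%:M - c^-1 *: diag_mx (sval2 X).
    apply/matrixP => i j; rewrite !mxE /w.
    by case: (i == j); rewrite ?mulr1n ?mulr0n ?mulr0 ?subr0 // mulrC.
  by rewrite mulmxBr mulmxBl mulmx1 svec_mulC -scalemxAr -scalemxAl -gram_spectral.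
rewrite -!mulmxA (mulmxA (svec X)) svec_mulCt mul1mx (mulmxA (diag_mx _)).
congr (_ *m (_ *m _)); rewrite mulmx_diag; congr diag_mx.
by apply/rowP => i; rewrite !mxE exprS.
Qed.

Lemma mxtrace_iter_gram k : \tr (iter k (mulmx T) 1%:M) = \sum_i w i ^+ k.
Proof.
rewrite iter_gram_spectral mxtrace_mulC mulmxA svec_mulCt mul1mx mxtrace_diag.
by apply: eq_bigr => i _; rewrite mxE.
Qed.

Lemma w_itv i : 0 <= w i <= 1.
Proof.
rewrite subr_ge0 gerBl ler_pdivrMr // mul1r sval2_le //=.
by rewrite divr_ge0 ?sval2_ge0 // ltW.
Qed.

Lemma iter_gram_diag_itv k s : 0 <= iter k (mulmx T) 1%:M s s <= 1.
Proof.
have -> : iter k (mulmx T) 1%:M s s = \sum_l w l ^+ k * `|svec X l s| ^+ 2.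
  rewrite iter_gram_spectral -mulmxA mxE; apply: eq_bigr => l _.
  by rewrite mul_diag_mx !mxE normCK mulrCA [_^* * _]mulrC.
have -> : 1 = \sum_l `|svec X l s| ^+ 2 :> C.
  transitivity (((svec X) ^t* *m svec X) s s); first by rewrite svec_mulC mxE eqxx.
  by rewrite mxE; apply: eq_bigr => l _; rewrite !mxE normCK mulrC.
have w0 l : 0 <= w l by have /andP[] := w_itv l.
rewrite sumr_ge0 => [|l _]; last by rewrite mulr_ge0 ?exprn_ge0.
apply: ler_sum => l _; have /andP[_ w1] := w_itv l.
by rewrite ler_piMl ?exprn_ge0 // exprn_ile1.
Qed.

Lemma mxtrace_iter_ge0 k : 0 <= \tr (iter k (mulmx T) 1%:M).
Proof.
rewrite mxtrace_iter_gram sumr_ge0 // => i _; rewrite exprn_ge0 //.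
by have /andP[] := w_itv i.
Qed.

Lemma mxtrace_iterS k :
  \tr (iter k.+1 (mulmx T) 1%:M) <= \tr (iter k (mulmx T) 1%:M).
Proof.
rewrite !mxtrace_iter_gram; apply: ler_sum => i _; have /andP[w0 w1] := w_itv i.
by rewrite exprS ler_piMl // exprn_ge0.
Qed.

Lemma corank_le_mxtrace k :
  (n - \rank X)%:R <= \tr (iter k (mulmx T) 1%:M) :> C.
Proof.
rewrite mxtrace_iter_gram (bigID [in [set i | sval2 X 0 i == 0]]) /=.
rewrite -card_sval2_eq0 -sum1_card natr_sum.
rewrite -[leLHS]addr0; apply: lerD.
  by apply: ler_sum => i; rewrite inE /w => /eqP ->; rewrite mul0r subr0 expr1n.
by apply: sumr_ge0 => i _; rewrite exprn_ge0 //; have /andP[] := w_itv i.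
Qed.

(** A singular value that is 0, at most [a], or greater than [a] contributes to
    the trace at most 1, 1, and [(1 - a / c) ^+ k] respectively. *)
Lemma mxtrace_le_corank k a : 0 < a -> a <= c ->
  \tr (iter k (mulmx T) 1%:M) <=
  (n - \rank X)%:R + #|[set i | 0 < sval2 X 0 i <= a]|%:R + n%:R * (1 - a / c) ^+ k.
Proof.
move=> a0 ac; rewrite mxtrace_iter_gram.
pose Z := [set i | sval2 X 0 i == 0]; pose A := [set i | 0 < sval2 X 0 i <= a].
have ac0 : 0 <= 1 - a / c by rewrite subr_ge0 ler_pdivrMr // mul1r.
apply: (@le_trans _ _ (\sum_i ((i \in Z)%:R + (i \in A)%:R + (1 - a / c) ^+ k))).
  apply: ler_sum => i _; have /andP[w0 w1] := w_itv i.
  have wk1 : w i ^+ k <= 1 by rewrite exprn_ile1.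
  have ack : 0 <= (1 - a / c) ^+ k by rewrite exprn_ge0.
  rewrite !inE; case: eqP => [_|/eqP d0].
    by apply: le_trans wk1 _; rewrite -addrA lerDl addr_ge0.
  rewrite lt_def d0 sval2_ge0 /= add0r.
  case: (boolP (_ <= a)) => da; first by apply: le_trans wk1 _; rewrite lerDl.
  rewrite add0r lerXn2r // lerD2l lerN2 ler_wpM2r ?invr_ge0 ?(ltW c_gt0) //.
  by move: da; rewrite -real_ltNge ?ger0_real ?sval2_ge0 ?(ltW a0) // => /ltW.
rewrite !big_split /= sumr_const card_ord -[(_ ^+ k) *+ n]mulr_natl lerD2r.
have cE (Y : {set 'I_n}) : \sum_i (i \in Y)%:R = #|Y|%:R :> C.
  by rewrite -natr_sum -sum1_card [in RHS]big_mkcond.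
by rewrite !cE card_sval2_eq0.
Qed.

End TracePowers.

Local Open Scope classical_set_scope.

#[local] Existing Instance summability.totally_filter.

(** * Unordered sums *)

Section UnorderedSums.
Context {R : realType} {G : groupType}.
Local Notation C := R[i].
Implicit Types (f : G -> C) (J : {fset G}).

Definition has_usum f (s : C) : Prop :=
  forall e : C, 0 < e -> exists J0, forall J, (J0 `<=` J)%fset ->
    `|\sum_(g <- J) f g - s| < e.

Definition abs_summable f : Prop :=
  exists b : C, forall J, \sum_(g <- J) `|f g| <= b.

Lemma fsetU_sub J1 J2 J : (J1 `|` J2 `<=` J)%fset ->
  (J1 `<=` J)%fset /\ (J2 `<=` J)%fset.
Proof. by rewrite fsubUset => /andP[]. Qed.

Lemma has_usumE f s : has_usum f s -> usum f = s.
Proof.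
move=> fs; have H : summability.partial_sum (f : G -> C^o) @ summability.totally --> (s : C^o).
  apply/cvgrPdist_lt => e e0; have [J0 HJ] := fs e e0.
  exists J0 => // J /= J0J; rewrite distrC /summability.partial_sum.
  have -> : \sum_(i : J) f (val i) = \sum_(g <- J) f g by rewrite big_seq_fsetE.
  exact: HJ.
exact: (@cvg_lim _ (@norm_hausdorff C C^o) _ _ summability.totally_filter _ _ H).
Qed.

Lemma has_usumD (f1 f2 : G -> C) s1 s2 : has_usum f1 s1 -> has_usum f2 s2 ->
  has_usum (fun g => f1 g + f2 g) (s1 + s2).
Proof.
move=> H1 H2 e e0; have e20 : 0 < e / 2 by rewrite divr_gt0.
have [J1 HJ1] := H1 _ e20; have [J2 HJ2] := H2 _ e20.
exists (J1 `|` J2)%fset => J /fsetU_sub[/HJ1 h1 /HJ2 h2].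
rewrite big_split /= opprD addrACA; apply: le_lt_trans (ler_normD _ _) _.
by rewrite [e]splitr ltrD.
Qed.

Lemma has_usumZ a f s : has_usum f s -> has_usum (fun g => a * f g) (a * s).
Proof.
move=> H e e0; have a1 : 0 < `|a| + 1 by rewrite ltr_wpDl.
have [J0 HJ] := H (e / (`|a| + 1)) (divr_gt0 e0 a1).
exists J0 => J /HJ; rewrite -mulr_sumr -mulrBr normrM ltr_pdivlMr //.
apply: le_lt_trans; rewrite mulrC ler_wpM2l // lerDl //.
Qed.

Lemma has_usum_conj f s : has_usum f s -> has_usum (fun g => (f g)^*) (s^*).
Proof.
move=> H e e0; have [J0 HJ] := H e e0; exists J0 => J /HJ.
by rewrite -rmorph_sum -rmorphB /= norm_conjC.
Qed.

Lemma has_usum_fin f J0 : (forall g, g \notin J0 -> f g = 0) ->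
  has_usum f (\sum_(g <- J0) f g).
Proof.
move=> f0 e e0; exists J0 => J J0J.
by rewrite (big_fset_incl _ J0J) ?subrr ?normr0 // => x _ /f0.
Qed.

Lemma sum_fset_image (h : G -> G) J f : injective h ->
  \sum_(g <- [fset h x | x in J]%fset) f g = \sum_(g <- J) f (h g).
Proof. by move=> hI; rewrite big_imfset //= => x y _ _ /hI. Qed.

Lemma has_usum_reindex (h h' : G -> G) f s : cancel h h' -> cancel h' h ->
  has_usum f s -> has_usum (f \o h) s.
Proof.
move=> hK h'K H e e0; have [J0 HJ] := H e e0.
exists [fset h' x | x in J0]%fset => J J0J.
rewrite -(sum_fset_image J f (can_inj hK)).
apply: HJ; apply/fsubsetP => x xJ0; apply/imfsetP; exists (h' x); rewrite ?h'K //.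
by apply: (fsubsetP J0J); apply/imfsetP; exists x.
Qed.

Lemma has_usum_norm_le f s b :
  has_usum f s -> (forall J, `|\sum_(g <- J) f g| <= b) -> `|s| <= b.
Proof.
move=> H fb; have b_real : b \is Num.real.
  by apply: ger0_real; apply: le_trans (fb fset0).
rewrite real_leNgt ?normr_real //; apply/negP => sb.
have sb0 : 0 < `|s| - b by rewrite subr_gt0.
have [J0 /(_ J0 (fsubset_refl _)) HJ] := H _ sb0.
move: HJ; rewrite distrC => /(le_lt_trans (lerB_dist _ _)).
by rewrite ltrD2l ltrN2 => /(le_lt_trans (fb J0)); rewrite ltxx.
Qed.

Lemma eq0_norm_lt (x : C) : (forall e : C, 0 < e -> `|x| < e) -> x = 0.
Proof.
move=> xe; apply/eqP; rewrite -normr_eq0; apply/negPn/negP => x0.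
by have := xe `|x|; rewrite ltxx lt_def x0 normr_ge0 => /(_ isT).
Qed.

(** Among complex numbers the nonnegative ones form a closed set, as the
    fixed points of the norm. *)
Lemma ge0_closed (t : C) :
  (forall e : C, 0 < e -> exists2 v : C, 0 <= v & `|v - t| < e) -> 0 <= t.
Proof.
move=> H; suff -> : t = `|t| by [].
apply/eqP; rewrite -subr_eq0; apply/eqP/eq0_norm_lt => e e0.
have [v v0 vt] := H (e / 2) (divr_gt0 e0 (ltr0n _ 2)).
have -> : t - `|t| = (t - v) + (v - `|t|) by ring.
apply: le_lt_trans (ler_normD _ _) _.
rewrite [e]splitr; apply: ltrD; first by rewrite distrC.
by have := ler_dist_dist v t; rewrite (ger0_norm v0) => /le_lt_trans; apply.
Qed.

Lemma ler_sum_fset J1 J2 f : (J1 `<=` J2)%fset -> (forall g, 0 <= f g) ->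
  \sum_(g <- J1) f g <= \sum_(g <- J2) f g.
Proof.
move=> J12 f0; rewrite [leRHS](big_fsetID _ [in J1]) /=.
have -> : [fset x in J2 | x \in J1]%fset = J1.
  apply/fsetP => x; rewrite !inE /=; apply/andP/idP => [[]//|xJ].
  by split=> //; exact: (fsubsetP J12).
by rewrite lerDl sumr_ge0.
Qed.

Lemma has_usum_ge f s J : has_usum f s -> (forall g, 0 <= f g) ->
  \sum_(g <- J) f g <= s.
Proof.
move=> H f0; rewrite -subr_ge0; apply: ge0_closed => e e0.
have [J0 /(_ (J `|` J0)%fset (fsubsetUr _ _)) HJ] := H _ e0.
exists (\sum_(g <- (J `|` J0)%fset) f g - \sum_(g <- J) f g).
  rewrite subr_ge0; exact: ler_sum_fset (fsubsetUl _ _) f0.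
by rewrite opprB addrA subrK.
Qed.

Lemma eq_has_usum f1 f2 s : f1 =1 f2 -> has_usum f1 s -> has_usum f2 s.
Proof. by move=> /funext ->. Qed.

Lemma pos_complexP (e : C) : 0 < e -> exists2 r : R, 0 < r & e = r%:C%C.
Proof.
move=> e0; exists (complex.Re e); last by rewrite RRe_real // gtr0_real.
by rewrite -ltcR RRe_real // gtr0_real.
Qed.

Lemma has_usum_real (h : G -> R) b : (forall g, 0 <= h g) ->
    (forall J, \sum_(g <- J) h g <= b) ->
  exists s : R, has_usum (fun g => (h g)%:C%C) s%:C%C.
Proof.
move=> h0 hb; pose A := [set \sum_(g <- J) h g | J in [set: {fset G}]].
have A_sup : has_sup A.
  by split; [exists (\sum_(g <- fset0) h g), fset0 | exists b => _ [J _ <-]].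
exists (sup A) => e /pos_complexP[r r0 ->].
have [_ [J0 _ <-] J0r] := sup_adherent r0 A_sup.
exists J0 => J J0J; rewrite -rmorph_sum -rmorphB /= normc_def /=.
rewrite expr0n addr0 sqrtr_sqr ltcR ltr_norml; apply/andP; split.
  rewrite ltrBrDl; apply: lt_le_trans J0r _.
  rewrite [leRHS](big_fsetID _ [in J0]) /=.
  have -> : [fset x in J | x \in J0]%fset = J0.
    apply/fsetP => x; rewrite !inE /=; apply/andP/idP => [[]//|xJ].
    by split=> //; exact: (fsubsetP J0J).
  by rewrite lerDl sumr_ge0.
apply: le_lt_trans r0; rewrite subr_le0; apply: sup_upper_bound => //.
by exists J.
Qed.

Lemma abs_summable_le (f1 f2 : G -> C) : (forall g, `|f1 g| <= `|f2 g|) ->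
  abs_summable f2 -> abs_summable f1.
Proof.
by move=> f12 [b Hb]; exists b => J; apply: le_trans (Hb J); exact: ler_sum.
Qed.

Lemma abs_summableD (f1 f2 : G -> C) : abs_summable f1 -> abs_summable f2 ->
  abs_summable (fun g => f1 g + f2 g).
Proof.
move=> [b1 H1] [b2 H2]; exists (b1 + b2) => J; apply: le_trans (lerD (H1 J) (H2 J)).
by rewrite -big_split /=; apply: ler_sum => g _; exact: ler_normD.
Qed.

Lemma abs_summableZ a (f : G -> C) : abs_summable f -> abs_summable (fun g => a * f g).
Proof.
move=> [b H]; exists (`|a| * b) => J.
under eq_bigr do rewrite normrM.
by rewrite -mulr_sumr ler_wpM2l.
Qed.

Lemma abs_summable_reindex (h h' : G -> G) f :
  cancel h h' -> abs_summable f -> abs_summable (f \o h).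
Proof.
move=> hK [b H]; exists b => J.
have <- := sum_fset_image J (fun g => `|f g|) (can_inj hK); exact: H.
Qed.

(** Reduced to nonnegative functions, whose sums are suprema: a real function [h]
    dominated by [nf] is the difference of [nf + h] and [nf]. *)
Lemma abs_summable_has_usum f : abs_summable f -> has_usum f (usum f).
Proof.
suff H : abs_summable f -> exists s, has_usum f s.
  by move=> /H[s fs]; rewrite (has_usumE fs).
move=> [b Hb].
pose nf g := complex.Re `|f g|.
have nfE g : (nf g)%:C%C = `|f g| by rewrite RRe_real ?normr_real.
have nf0 g : 0 <= nf g by rewrite -ler0c nfE.
have nfb J : \sum_(g <- J) nf g <= complex.Re b.
  have := Hb J; under eq_bigr do rewrite -nfE.
  by rewrite -rmorph_sum /= lecE => /andP[].
have shifted (h : G -> R) : (forall g, `|h g| <= nf g) ->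
    exists s : C, has_usum (fun g => (h g)%:C%C) s.
  move=> hnf.
  have [|J|s1 H1] := @has_usum_real (fun g => nf g + h g) (complex.Re b + complex.Re b).
  - by move=> g; have := hnf g; rewrite ler_norml => /andP[]; rewrite -subr_ge0 opprK addrC.
  - rewrite big_split /= lerD //; apply: le_trans (nfb J); apply: ler_sum => g _.
    by apply: le_trans (hnf g); exact: ler_norm.
  have [s2 H2] := has_usum_real nf0 nfb.
  exists (s1%:C%C + (-1) * s2%:C%C).
  apply: eq_has_usum (has_usumD H1 (has_usumZ (-1) H2)) => g.
  by rewrite mulN1r -rmorphB /= addrAC subrr add0r.
have [g|s1 H1] := shifted (fun g => complex.Re (f g)).
  by rewrite -lecR nfE normc_Re_le.
have [g|s2 H2] := shifted (fun g => complex.Im (f g)).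
  by rewrite -lecR nfE normc_Im_le.
exists (s1 + 'i%C * s2).
by apply: eq_has_usum (has_usumD H1 (has_usumZ 'i%C H2)) => g; rewrite -complexE.
Qed.

End UnorderedSums.

(** * Square summable functions *)

Section SquareSummable.
Context {R : realType} {G : groupType}.
Local Notation C := R[i].
Implicit Types (x y z : G -> C).

Lemma l2P x : l2 x <-> abs_summable (fun g => `|x g| ^+ 2).
Proof.
have nE g : `|x g| ^+ 2 = (Normc.normc (x g) ^+ 2)%:C%C by rewrite rmorphXn.
have sE J : \sum_(g <- J) `| `|x g| ^+ 2 | = (\sum_(g <- J) Normc.normc (x g) ^+ 2)%:C%C.
  by rewrite rmorph_sum; apply: eq_bigr => g _; rewrite ger0_norm ?exprn_ge0 ?nE.
have esE (X : set G) : finite_set X ->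
    (\sum_(g \in X) `|(Normc.normc (x g) ^+ 2)%:E| =
     (\sum_(g <- fset_set X) Normc.normc (x g) ^+ 2)%:E)%E.
  move=> fX; rewrite fsbig_finite //= -sumEFin; apply: eq_bigr => g _.
  by rewrite ger0_norm ?sqr_ge0.
rewrite /l2 /= /summable; split=> [fin|[b Hb]].
  exists (fine (\esum_(g in [set: G]) `|(Normc.normc (x g) ^+ 2)%:E|)%E)%:C%C => J.
  rewrite sE lecR -lee_fin fineK; last first.
    by rewrite fin_numElt fin andbT (lt_le_trans (ltNyr 0)) // esum_ge0.
  apply: esum_ge; exists [set` J]; first by split=> //; exact: finite_fset.
  by rewrite esE ?set_fsetK //; exact: finite_fset.
apply: (@le_lt_trans _ _ (complex.Re b)%:E); last exact: ltry.
apply: ge_ereal_sup => _ [X [fX _] <-]; rewrite esE // lee_fin.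
by have := Hb (fset_set X); rewrite sE lecE => /andP[].
Qed.

Lemma l2_abs_summable_mul x y : l2 x -> l2 y ->
  abs_summable (fun g => x g * (y g)^*).
Proof.
move=> /l2P Hx /l2P Hy; apply: abs_summable_le (abs_summableD Hx Hy) => g.
rewrite normrM norm_conjC [leRHS]ger0_norm ?addr_ge0 ?exprn_ge0 //.
rewrite -subr_ge0.
have -> : `|x g| ^+ 2 + `|y g| ^+ 2 - `|x g| * `|y g| =
  (`|x g| - `|y g|) ^+ 2 + `|x g| * `|y g| by ring.
by rewrite addr_ge0 // real_exprn_even_ge0 // rpredB ?normr_real.
Qed.

Lemma l2_dot_has_usum x y : l2 x -> l2 y ->
  has_usum (fun g => x g * (y g)^*) (l2_dot x y).
Proof. by move=> Hx Hy; apply: abs_summable_has_usum; exact: l2_abs_summable_mul. Qed.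

Lemma l2D x y : l2 x -> l2 y -> l2 (fun g => x g + y g).
Proof.
move=> /l2P Hx /l2P Hy; apply/l2P.
apply: abs_summable_le (abs_summableZ 2 (abs_summableD Hx Hy)) => g.
rewrite [leLHS]ger0_norm ?[leRHS]ger0_norm ?mulr_ge0 ?addr_ge0 ?exprn_ge0 //.
apply: (@le_trans _ _ ((`|x g| + `|y g|) ^+ 2)).
  by rewrite lerXn2r ?nnegrE ?addr_ge0 ?ler_normD.
rewrite -subr_ge0.
have -> : 2 * (`|x g| ^+ 2 + `|y g| ^+ 2) - (`|x g| + `|y g|) ^+ 2 =
  (`|x g| - `|y g|) ^+ 2 by ring.
by rewrite real_exprn_even_ge0 // rpredB ?normr_real.
Qed.

Lemma l2Z a x : l2 x -> l2 (fun g => a * x g).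
Proof.
move=> /l2P Hx; apply/l2P; apply: abs_summable_le (abs_summableZ (`|a| ^+ 2) Hx) => g.
by rewrite [ `|a * x g| ]normrM exprMn.
Qed.

Lemma l2_shift (h h' : G -> G) x : cancel h h' -> l2 x -> l2 (x \o h).
Proof. by move=> hK /l2P Hx; apply/l2P; exact: abs_summable_reindex hK Hx. Qed.

Lemma l2_fin (J0 : {fset G}) x : (forall g, g \notin J0 -> x g = 0) -> l2 x.
Proof.
move=> x0; apply/l2P; exists (\sum_(g <- J0) `| `|x g| ^+ 2|) => J.
rewrite [leLHS](_ : _ = \sum_(g <- (J `&` J0)%fset) `| `|x g| ^+ 2 |).
  by apply: ler_sum_fset => //; exact: fsubsetIr.
apply/esym/big_fset_incl; first exact: fsubsetIl.
by move=> g gJ; rewrite inE gJ /= => /x0 ->; rewrite normr0 expr0n normr0.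
Qed.

Lemma eq_l2 x y : x =1 y -> l2 x -> l2 y.
Proof. by move=> /funext ->. Qed.

Lemma l2_0 : @l2 R G (fun=> 0).
Proof. by apply: (@l2_fin fset0). Qed.

Lemma l2_sum (I : Type) (r : seq I) (F : I -> G -> C) :
  (forall i, l2 (F i)) -> l2 (fun g => \sum_(i <- r) F i g).
Proof.
move=> HF; elim: r => [|i r IHr].
  by apply: eq_l2 l2_0 => g; rewrite big_nil.
by apply: eq_l2 (l2D (HF i) IHr) => g; rewrite big_cons.
Qed.

End SquareSummable.

Section InnerProduct.
Context {R : realType} {G : groupType}.
Local Notation C := R[i].
Implicit Types (x y z : G -> C).

Lemma l2_dotDl a x z y : l2 x -> l2 z -> l2 y ->
  l2_dot (fun g => a * x g + z g) y = a * l2_dot x y + l2_dot z y.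
Proof.
move=> Hx Hz Hy; apply: has_usumE.
have := has_usumD (has_usumZ a (l2_dot_has_usum Hx Hy)) (l2_dot_has_usum Hz Hy).
by apply: eq_has_usum => g; rewrite mulrDl mulrA.
Qed.

Lemma l2_dotC x y : l2 x -> l2 y -> l2_dot y x = (l2_dot x y)^*.
Proof.
move=> Hx Hy; apply: has_usumE; have := has_usum_conj (l2_dot_has_usum Hx Hy).
by apply: eq_has_usum => g; rewrite rmorphM /= conjCK mulrC.
Qed.

Lemma l2_dot0l y : l2_dot (fun=> 0) y = 0.
Proof.
apply: has_usumE.
have := @has_usum_fin R G (fun g => 0 * (y g)^*) fset0.
by rewrite big_seq_fset0; apply => g _; rewrite mul0r.
Qed.

Lemma l2_dotZl a x y : l2 x -> l2 y -> l2_dot (fun g => a * x g) y = a * l2_dot x y.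
Proof.
move=> Hx Hy; have := l2_dotDl a Hx l2_0 Hy; rewrite l2_dot0l // addr0 => <-.
by congr l2_dot; apply/funext => g; rewrite addr0.
Qed.

Lemma l2_dot_suml (I : Type) (r : seq I) (F : I -> G -> C) y :
    (forall i, l2 (F i)) -> l2 y ->
  l2_dot (fun g => \sum_(i <- r) F i g) y = \sum_(i <- r) l2_dot (F i) y.
Proof.
move=> HF Hy; elim: r => [|i r IHr].
  rewrite big_nil -[RHS](l2_dot0l y); congr l2_dot.
  by apply/funext => g; rewrite big_nil.
rewrite big_cons -IHr -[l2_dot (F i) y]mul1r.
rewrite -(l2_dotDl 1 (HF i) (l2_sum _ HF) Hy); congr l2_dot.
by apply/funext => g; rewrite big_cons mul1r.
Qed.

Lemma l2_dot_shift (h : G) x y : l2 x -> l2 y ->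
  l2_dot (fun g => x (h^-1 * g)%g) y = l2_dot x (fun g => y (h * g)%g).
Proof.
move=> Hx Hy; apply: has_usumE.
have Hy' : l2 (fun g => y (h * g)%g) by apply: l2_shift (mulKg h) Hy.
have := has_usum_reindex (mulKVg h) (mulKg h) (l2_dot_has_usum Hx Hy').
by apply: eq_has_usum => g; rewrite /= mulKVg.
Qed.

Lemma l2_dot_ge x (J : {fset G}) : l2 x ->
  \sum_(g <- J) `|x g| ^+ 2 <= l2_dot x x.
Proof.
move=> Hx.
under eq_bigr do rewrite normCK.
apply: (has_usum_ge J (l2_dot_has_usum Hx Hx)) => g; exact: mul_conjC_ge0.
Qed.

(** Cauchy--Schwarz in its linearised form. *)
Lemma l2_dot_amgm (t : C) x y : 0 < t -> l2 x -> l2 y ->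
  `|l2_dot x y| <= t * l2_dot x x + t^-1 * l2_dot y y.
Proof.
move=> t0 Hx Hy; apply: has_usum_norm_le (l2_dot_has_usum Hx Hy) _ => J.
apply: le_trans (ler_norm_sum _ _ _) _.
have ti0 : 0 < t^-1 by rewrite invr_gt0.
apply: (@le_trans _ _ (t * (\sum_(g <- J) `|x g| ^+ 2) +
                       t^-1 * \sum_(g <- J) `|y g| ^+ 2)); last first.
  by rewrite lerD // ler_pM2l // l2_dot_ge.
rewrite !mulr_sumr -big_split /=; apply: ler_sum => g _.
rewrite normrM norm_conjC -subr_ge0.
have -> : t * `|x g| ^+ 2 + t^-1 * `|y g| ^+ 2 - `|x g| * `|y g| =
  t^-1 * ((t * `|x g| - 2^-1 * `|y g|) ^+ 2 + 3 / 4 * `|y g| ^+ 2).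
  by field; rewrite gt_eqF.
apply: mulr_ge0; first exact: ltW.
apply: addr_ge0; last first.
  by rewrite mulr_ge0 ?exprn_ge0 // divr_ge0.
by rewrite real_exprn_even_ge0 // rpredB // rpredM ?normr_real // ger0_real // ltW.
Qed.

Lemma l2_dot_ge0 x : l2 x -> 0 <= l2_dot x x.
Proof. by move=> Hx; have := l2_dot_ge fset0 Hx; rewrite big_seq_fset0. Qed.

Lemma l2_delta_dot x : l2 x -> l2_dot x (delta R 1%g) = x 1%g.
Proof.
move=> Hx; apply: has_usumE.
have := @has_usum_fin R G (fun g => x g * (delta R 1%g g)^*) [fset 1%g]%fset.
rewrite big_seq_fset1 /delta eqxx conjC1 mulr1; apply => g.
by rewrite inE => /negbTE ->; rewrite conjC0 mulr0.
Qed.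

Lemma l2_delta : l2 (@delta R G 1%g).
Proof. by apply: (@l2_fin _ _ [fset 1%g]%fset) => g; rewrite inE /delta => /negbTE ->. Qed.

End InnerProduct.

(** * Matrices over the group ring as operators *)

Section DirectSum.
Context {R : realType} {G : groupType} {n : nat}.
Local Notation C := R[i].
Local Notation vec := ('I_n -> G -> C).
Implicit Types (x y z : vec).

Definition lincomb (a : C) x y : vec := fun i g => a * x i g + y i g.

Lemma l2n_lincomb a x y : l2n x -> l2n y -> l2n (lincomb a x y).
Proof. by move=> Hx Hy i; exact: l2D (l2Z a (Hx i)) (Hy i). Qed.

Lemma l2n_dotDl a x z y : l2n x -> l2n z -> l2n y ->
  l2n_dot (lincomb a x z) y = a * l2n_dot x y + l2n_dot z y.
Proof.
move=> Hx Hz Hy; rewrite /l2n_dot mulr_sumr -big_split /=.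
by apply: eq_bigr => i _; rewrite l2_dotDl.
Qed.

Lemma l2n_dotC x y : l2n x -> l2n y -> l2n_dot y x = (l2n_dot x y)^*.
Proof.
move=> Hx Hy; rewrite /l2n_dot rmorph_sum; apply: eq_bigr => i _.
by rewrite l2_dotC.
Qed.

Lemma l2n_dotDr a x z y : l2n x -> l2n z -> l2n y ->
  l2n_dot y (lincomb a x z) = a^* * l2n_dot y x + l2n_dot y z.
Proof.
move=> Hx Hz Hy; rewrite (l2n_dotC (l2n_lincomb a Hx Hz) Hy) l2n_dotDl //.
by rewrite rmorphD rmorphM /= -!l2n_dotC.
Qed.

Lemma l2_dot_le_l2n_dot x i : l2n x -> l2_dot (x i) (x i) <= l2n_dot x x.
Proof.
move=> Hx; rewrite /l2n_dot (bigD1 i) //= lerDl.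
by apply: sumr_ge0 => j _; exact: l2_dot_ge0.
Qed.

Lemma l2n_dot_ge0 x : l2n x -> 0 <= l2n_dot x x.
Proof. by move=> Hx; apply: sumr_ge0 => i _; exact: l2_dot_ge0. Qed.

Lemma coord_le_l2n_dot x i g : l2n x -> `|x i g| ^+ 2 <= l2n_dot x x.
Proof.
move=> Hx; apply: le_trans (l2_dot_le_l2n_dot i Hx).
by have := l2_dot_ge [fset g]%fset (Hx i); rewrite big_seq_fset1.
Qed.

Lemma l2n_dot_eq0 x : l2n x -> l2n_dot x x = 0 -> forall i g, x i g = 0.
Proof.
move=> Hx x0 i g; have := coord_le_l2n_dot i g Hx; rewrite x0 => le0.
have : `|x i g| ^+ 2 == 0 by rewrite eq_le le0 exprn_ge0.
by rewrite expf_eq0 normr_eq0 => /eqP.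
Qed.

Lemma l2n_dot_amgm (t : C) x y : 0 < t -> l2n x -> l2n y ->
  `|l2n_dot x y| <= t * l2n_dot x x + t^-1 * l2n_dot y y.
Proof.
move=> t0 Hx Hy; apply: le_trans (ler_norm_sum _ _ _) _.
by rewrite /l2n_dot !mulr_sumr -big_split; apply: ler_sum => i _; exact: l2_dot_amgm.
Qed.

(** An entry is a list of terms rather than a finitely supported function, so
    that the adjoint is a [map] and like terms need not be collected. *)
Definition grmx := 'I_n -> 'I_n -> seq (C * G).

Definition kop (a : grmx) x : vec := fun i g =>
  \sum_j \sum_(t <- a i j) t.1 * x j (t.2^-1 * g)%g.

Definition kadj (a : grmx) : grmx := fun i j =>
  [seq ((t.1)^*, (t.2)^-1%g) | t <- a j i].

Lemma kadjK a : kadj (kadj a) = a.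
Proof.
apply/funext => i; apply/funext => j; rewrite /kadj -map_comp -[RHS]map_id.
by apply: eq_map => -[c g] /=; rewrite conjCK invgK.
Qed.

Lemma l2n_kop a x : l2n x -> l2n (kop a x).
Proof.
move=> Hx i; apply: l2_sum => j; apply: l2_sum => t; apply: l2Z.
by apply: (l2_shift (mulKVg t.2)); exact: Hx.
Qed.

Lemma kop_adjoint a x y : l2n x -> l2n y ->
  l2n_dot (kop a x) y = l2n_dot x (kop (kadj a) y).
Proof.
move=> Hx Hy.
have Hs (t : C * G) j : l2 (fun g => x j (t.2^-1 * g)%g).
  by apply: (l2_shift (mulKVg t.2)); exact: Hx.
have Hs' (t : C * G) j : l2 (fun g => y j (t.2 * g)%g).
  by apply: (l2_shift (mulKg t.2)); exact: Hy.
transitivity (\sum_i \sum_j \sum_(t <- a i j)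
    t.1 * l2_dot (x j) (fun g => y i (t.2 * g)%g)).
  apply: eq_bigr => i _; rewrite l2_dot_suml //; last first.
    by move=> j; apply: l2_sum => t; exact: l2Z.
  apply: eq_bigr => j _; rewrite l2_dot_suml // => [|t]; last exact: l2Z.
  by apply: eq_bigr => t _; rewrite l2_dotZl // l2_dot_shift.
rewrite exchange_big /=; apply: eq_bigr => j _.
rewrite [RHS]l2_dotC; [|exact: l2n_kop|exact: Hx].
rewrite l2_dot_suml //; last first.
  move=> i; apply: l2_sum => t; apply: l2Z.
  by apply: (l2_shift (mulKVg t.2)); exact: Hy.
rewrite rmorph_sum; apply: eq_bigr => i _; rewrite /kadj.
have -> : (fun g => \sum_(t <- kadj a j i) t.1 * y i (t.2^-1 * g)%g) =
          (fun g => \sum_(t <- a i j) (t.1)^* * y i (t.2 * g)%g).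
  by apply/funext => g; rewrite big_map; apply: eq_bigr => t _; rewrite invgK.
rewrite l2_dot_suml // => [|t]; last exact: l2Z.
rewrite rmorph_sum; apply: eq_bigr => t _.
by rewrite l2_dotZl // rmorphM /= conjCK -l2_dotC.
Qed.

Lemma kop_lincomb a c x y : kop a (lincomb c x y) = lincomb c (kop a x) (kop a y).
Proof.
apply/funext => i; apply/funext => g; rewrite /kop /lincomb mulr_sumr -big_split.
apply: eq_bigr => j _; rewrite mulr_sumr -big_split; apply: eq_bigr => t _ /=.
by rewrite mulrDr mulrCA.
Qed.

End DirectSum.

(** * Sequences of complex numbers *)

Section ComplexSequences.
Context {R : realType}.
Local Notation C := R[i].
Implicit Types (u v : nat -> C) (l : C).

Definition ccvg u l : Prop :=
  forall e : C, 0 < e -> exists K, forall k, (K <= k)%N -> `|u k - l| < e.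

Lemma ccvg_comb a u v l l' : ccvg u l -> ccvg v l' ->
  ccvg (fun k => a * u k + v k) (a * l + l').
Proof.
move=> Hu Hv e e0; have a1 : 0 < `|a| + 1 by rewrite ltr_wpDl.
have e2 : 0 < e / 2 by rewrite divr_gt0.
have [K1 H1] := Hu _ (divr_gt0 e2 a1); have [K2 H2] := Hv _ e2.
exists (maxn K1 K2) => k; rewrite geq_max => /andP[/H1 h1 /H2 h2].
rewrite opprD addrACA -mulrBr; apply: le_lt_trans (ler_normD _ _) _.
rewrite [e]splitr; apply: ler_ltD => //; rewrite normrM.
move: h1; rewrite ltr_pdivlMr // => /ltW; apply: le_trans.
by rewrite mulrC ler_wpM2l // lerDl.
Qed.

Lemma ccvg_cst l : ccvg (fun=> l) l.
Proof. by move=> e e0; exists 0%N => k _; rewrite subrr normr0. Qed.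

Lemma ccvg_sum (I : Type) (r : seq I) (F : I -> nat -> C) (L : I -> C) :
    (forall i, ccvg (F i) (L i)) ->
  ccvg (fun k => \sum_(i <- r) F i k) (\sum_(i <- r) L i).
Proof.
move=> H; elim: r => [|i r IHr].
  by under [X in ccvg X]funext do rewrite big_nil; rewrite big_nil; exact: ccvg_cst.
rewrite big_cons -[L i]mul1r; under [X in ccvg X]funext do rewrite big_cons -[F i _]mul1r.
exact: ccvg_comb.
Qed.

Lemma ccvg_le u l b K : ccvg u l -> (forall k, (K <= k)%N -> `|u k| <= b) -> `|l| <= b.
Proof.
move=> H ub; have b_real : b \is Num.real.
  by apply: ger0_real; apply: le_trans (ub K (leqnn _)).
rewrite real_leNgt ?normr_real //; apply/negP; rewrite -subr_gt0 => bl.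
have [K' H'] := H _ bl.
have := H' _ (leq_maxr K K'); rewrite distrC => /(le_lt_trans (lerB_dist _ _)).
rewrite ltrD2l ltrN2 => /lt_le_trans/(_ (ub _ (leq_maxl K K'))).
by rewrite ltxx.
Qed.

Lemma ccvg_norm2 u l : ccvg u l -> ccvg (fun k => `|u k| ^+ 2) (`|l| ^+ 2).
Proof.
move=> H e e0; have l1 : 0 < 2 * `|l| + 1 by rewrite ltr_wpDl // mulr_ge0.
have [K1 H1] := H 1 ltr01; have [K2 H2] := H _ (divr_gt0 e0 l1).
exists (maxn K1 K2) => k; rewrite geq_max => /andP[/H1 h1 /H2].
rewrite ltr_pdivlMr // => h2; rewrite subr_sqr normrM.
apply: le_lt_trans h2; apply: ler_pM => //; first exact: ler_dist_dist.
rewrite ger0_norm ?addr_ge0 //.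
have -> : `|u k| = `|u k - l + l| by rewrite subrK.
have -> : 2 * `|l| + 1 = 1 + `|l| + `|l| by ring.
rewrite lerD2r; apply: le_trans (ler_normD _ _) _; rewrite lerD2r; exact: ltW.
Qed.

Lemma ccvg_uniq u l l' : ccvg u l -> ccvg u l' -> l = l'.
Proof.
move=> H H'; apply/eqP; rewrite -subr_eq0; apply/eqP/eq0_norm_lt => e e0.
have e2 : 0 < e / 2 by rewrite divr_gt0.
have [K1 h1] := H _ e2; have [K2 h2] := H' _ e2.
have -> : l - l' = (u (maxn K1 K2) - l') - (u (maxn K1 K2) - l) by ring.
apply: le_lt_trans (ler_normB _ _) _; rewrite [e]splitr.
by apply: ltrD; [exact: h2 (leq_maxr _ _) | exact: h1 (leq_maxl _ _)].
Qed.

Lemma real_cauchy_lim (u : nat -> R) :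
    (forall e : R, 0 < e -> exists K, forall k, (K <= k)%N -> `|u K - u k| < e) ->
  exists l : R, forall e : R, 0 < e ->
    exists K, forall k, (K <= k)%N -> `|u k - l| < e.
Proof.
move=> H; have /cauchy_cvg : cauchy (u @ \oo).
  apply: cauchy_exP => e e0; have [K HK] := H e e0; exists (u K).
  by exists K => // k /= Kk; exact: HK.
move=> /cvgrPdist_lt ul; exists (lim (u @ \oo)) => e /ul[K _ HK].
by exists K => k Kk; rewrite distrC; exact: HK.
Qed.

Lemma ccvg_cauchy u :
    (forall e : C, 0 < e -> exists K, forall k, (K <= k)%N -> `|u K - u k| < e) ->
  exists l, ccvg u l.
Proof.
move=> H.
have [e e0|r Hr] := @real_cauchy_lim (fun k => complex.Re (u k)).
  have [|K HK] := H e%:C%C; first by rewrite -[0]/(0%:C%C) ltcR.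
  exists K => k /HK; rewrite -ltcR; apply: le_lt_trans.
  by apply: le_trans (normc_Re_le _); rewrite raddfB.
have [e e0|s Hs] := @real_cauchy_lim (fun k => complex.Im (u k)).
  have [|K HK] := H e%:C%C; first by rewrite -[0]/(0%:C%C) ltcR.
  exists K => k /HK; rewrite -ltcR; apply: le_lt_trans.
  by apply: le_trans (normc_Im_le _); rewrite raddfB.
exists (r +i* s)%C => e /pos_complexP[f f0 ->].
have f2 : 0 < f / 2 by rewrite divr_gt0.
have [K1 h1] := Hr _ f2; have [K2 h2] := Hs _ f2.
exists (maxn K1 K2) => k; rewrite geq_max => /andP[/h1 k1 /h2 k2].
apply: le_lt_trans (normc_le_ReIm _) _; rewrite ltcR !raddfB /= [f]splitr.
exact: ltrD.
Qed.

Lemma antitone_lim u : (forall k, 0 <= u k) -> (forall k, u k.+1 <= u k) ->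
  exists2 l, (forall k, l <= u k) & ccvg u l.
Proof.
move=> u0 uS; have uE k : (complex.Re (u k))%:C%C = u k by rewrite RRe_real ?ger0_real.
pose v k := complex.Re (u k).
have v_mono : nonincreasing_seq v.
  by apply/nonincreasing_seqP => k; rewrite -lecR !uE.
have v_lb : has_lbound (range v) by exists 0 => _ [k _ <-]; rewrite -ler0c uE.
have v_cvg := nonincreasing_is_cvgn v_mono v_lb.
exists (lim (v @ \oo))%:C%C => [k|e /pos_complexP[f f0 ->]].
  by rewrite -uE lecR; exact: nonincreasing_cvgn_ge.
have /cvgrPdist_lt/(_ f f0)[K _ HK] := v_cvg.
exists K => k Kk; rewrite -uE -rmorphB /= normc_def /= expr0n addr0 sqrtr_sqr ltcR.
by rewrite distrC; exact: HK.
Qed.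

End ComplexSequences.

(** * The projection onto a kernel *)

Section KernelProjection.
Context {R : realType} {G : groupType} {n : nat}.
Local Notation C := R[i].
Local Notation vec := ('I_n -> G -> C).
Variables (b : @grmx R G n) (c : C).
Hypothesis c_gt0 : 0 < c.

(** The contraction [1 - b^* b / c]: its powers converge to the orthogonal
    projection onto the kernel of [b] when [c] bounds the squared norm of [b]. *)
Definition damp (x : vec) : vec := lincomb (- c^-1) (kop (kadj b) (kop b x)) x.

Definition basis_vec (i : 'I_n) : vec := l2n_inj i (delta R 1%g).

Definition trace_pow (k : nat) : C := \sum_i iter k damp (basis_vec i) i 1%g.

Definition kernel_space : set vec := [set x | l2n x /\ forall i g, kop b x i g = 0].

Let conj_c : (- c^-1)^* = - c^-1.
Proof. by rewrite rmorphN fmorphV /= (CrealP _) // gtr0_real. Qed.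

Lemma l2n_damp x : l2n x -> l2n (damp x).
Proof. by move=> Hx; apply: l2n_lincomb => //; do 2!apply: l2n_kop. Qed.

Lemma l2n_iter_damp k x : l2n x -> l2n (iter k damp x).
Proof. by move=> Hx; elim: k => //= k; exact: l2n_damp. Qed.

Lemma l2n_basis i : l2n (basis_vec i).
Proof.
move=> j; rewrite /basis_vec /l2n_inj.
by case: (j == i); [exact: l2_delta | exact: l2_0].
Qed.

Lemma l2n_dot_basis x i : l2n x -> l2n_dot x (basis_vec i) = x i 1%g.
Proof.
move=> Hx; rewrite /l2n_dot (bigD1 i) //= /basis_vec /l2n_inj eqxx.
have -> : (fun g => delta R 1%g g) = @delta R G 1%g by [].
rewrite l2_delta_dot // big1 ?addr0 // => j ji.
by rewrite (negbTE ji) (l2_dotC l2_0 (Hx j)) l2_dot0l conjC0.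
Qed.

Lemma kop_normE x : l2n x ->
  l2n_dot (kop b x) (kop b x) = c * (l2n_dot x x - l2n_dot (damp x) x).
Proof.
move=> Hx; have Hbx := l2n_kop b Hx; have Hbbx := l2n_kop (kadj b) Hbx.
rewrite l2n_dotDl // [l2n_dot (kop (kadj b) _) x]kop_adjoint ?kadjK //.
by field; rewrite gt_eqF.
Qed.

Lemma damp_self_adjoint x y : l2n x -> l2n y ->
  l2n_dot (damp x) y = l2n_dot x (damp y).
Proof.
move=> Hx Hy; have Hbx := l2n_kop b Hx; have Hby := l2n_kop b Hy.
rewrite l2n_dotDl ?l2n_dotDr ?conj_c //; try exact: l2n_kop.
by rewrite kop_adjoint // kadjK kop_adjoint.
Qed.

Lemma iter_damp_dot k l x y : l2n x -> l2n y ->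
  l2n_dot (iter k damp x) (iter l damp y) = l2n_dot (iter (l + k) damp x) y.
Proof.
move=> Hx Hy; elim: l k => //= l IHl k.
rewrite -damp_self_adjoint; [|exact: l2n_iter_damp..].
by have := IHl k.+1; rewrite addnS.
Qed.

Lemma damp_fix x : kernel_space x -> damp x = x.
Proof.
move=> [Hx bx0]; apply/funext => i; apply/funext => g; rewrite /damp /lincomb.
have -> : kop b x = fun _ _ => 0 by apply/funext => j; apply/funext => h.
by rewrite {1}/kop big1 ?mulr0 ?add0r // => j _; rewrite big1 // => t _; rewrite mulr0.
Qed.

Lemma iter_damp_fix k x : kernel_space x -> iter k damp x = x.
Proof. by move=> Vx; elim: k => //= k ->; exact: damp_fix. Qed.

Hypothesis trace_pow_ge0 : forall k, 0 <= trace_pow k.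
Hypothesis trace_powS : forall k, trace_pow k.+1 <= trace_pow k.

Lemma iter_basis_dot i k l :
  l2n_dot (iter k damp (basis_vec i)) (iter l damp (basis_vec i)) =
  iter (k + l) damp (basis_vec i) i 1%g.
Proof.
have Hd := l2n_basis i.
by rewrite iter_damp_dot // l2n_dot_basis 1?addnC //; exact: l2n_iter_damp.
Qed.

(** The right-hand side is the sum over all basis vectors of the squared
    distances, each of which is expanded by self-adjointness. *)
Lemma iter_basis_dist i k l :
  l2n_dot (lincomb (-1) (iter k damp (basis_vec i)) (iter l damp (basis_vec i)))
          (lincomb (-1) (iter k damp (basis_vec i)) (iter l damp (basis_vec i)))
  <= trace_pow (k + k) - 2 * trace_pow (k + l) + trace_pow (l + l).
Proof.
have E j : l2n_dot (lincomb (-1) (iter k damp (basis_vec j)) (iter l damp (basis_vec j)))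
          (lincomb (-1) (iter k damp (basis_vec j)) (iter l damp (basis_vec j))) =
    iter (k + k) damp (basis_vec j) j 1%g - 2 * iter (k + l) damp (basis_vec j) j 1%g
    + iter (l + l) damp (basis_vec j) j 1%g.
  have Hk := l2n_iter_damp k (l2n_basis j); have Hl := l2n_iter_damp l (l2n_basis j).
  have HL := l2n_lincomb (-1) Hk Hl.
  rewrite l2n_dotDl // !l2n_dotDr // !iter_basis_dot rmorphN1.
  by rewrite [(l + k)%N]addnC; ring.
rewrite /trace_pow mulr_sumr -sumrB -big_split /=.
under [leRHS]eq_bigr => j _ do rewrite -E.
rewrite (bigD1 i) //= lerDl; apply: sumr_ge0 => j _; apply: l2n_dot_ge0.
by apply: l2n_lincomb; apply: l2n_iter_damp; exact: l2n_basis.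
Qed.

Lemma kop_iter_le i k :
  l2n_dot (kop b (iter k damp (basis_vec i))) (kop b (iter k damp (basis_vec i)))
  <= c * (trace_pow (k + k) - trace_pow (k + k).+1).
Proof.
have E j : l2n_dot (kop b (iter k damp (basis_vec j))) (kop b (iter k damp (basis_vec j)))
   = c * (iter (k + k) damp (basis_vec j) j 1%g - iter (k + k).+1 damp (basis_vec j) j 1%g).
  have Hk := l2n_iter_damp k (l2n_basis j).
  rewrite kop_normE // iter_basis_dot.
  by rewrite -[damp (iter k damp _)]iterS iter_basis_dot addSn.
rewrite /trace_pow -sumrB mulr_sumr.
under [leRHS]eq_bigr => j _ do rewrite -E.
rewrite (bigD1 i) //= lerDl; apply: sumr_ge0 => j _; apply: l2n_dot_ge0.
by apply: l2n_kop; apply: l2n_iter_damp; exact: l2n_basis.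
Qed.


Lemma iter_basis_close e : 0 < e -> exists K, forall k l i, (K <= k)%N -> (K <= l)%N ->
  l2n_dot (lincomb (-1) (iter k damp (basis_vec i)) (iter l damp (basis_vec i)))
          (lincomb (-1) (iter k damp (basis_vec i)) (iter l damp (basis_vec i))) <= e /\
  l2n_dot (kop b (iter k damp (basis_vec i))) (kop b (iter k damp (basis_vec i))) <= c * e.
Proof.
move=> e0; have [s sle slim] := antitone_lim trace_pow_ge0 trace_powS.
have e2 : 0 < e / 2 by rewrite divr_gt0.
have [K HK] := slim _ e2.
have up k : (K <= k)%N -> trace_pow k <= s + e / 2.
  move=> /HK kd; rewrite -lerBlDl; apply: le_trans (ltW kd).
  by rewrite real_ler_norm // ger0_real // subr_ge0.
exists K => k l i Kk Kl.
have K2 k' : (K <= k')%N -> (K <= k' + k')%N by move=> h; apply: leq_trans h (leq_addr _ _).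
split.
  apply: le_trans (iter_basis_dist i k l) _.
  have -> : e = (s + e / 2) - 2 * s + (s + e / 2) by field.
  apply: lerD; last by rewrite up // K2.
  by apply: lerB; [rewrite up // K2 | rewrite ler_wpM2l].
apply: le_trans (kop_iter_le i k) _; rewrite ler_wpM2l //; first exact: ltW.
apply: (@le_trans _ _ (e / 2)); last by rewrite ler_pdivrMr // ler_peMr ?ler1n // ltW.
by rewrite lerBlDr addrC; apply: le_trans (up _ (K2 _ Kk)) _; rewrite lerD2r.
Qed.

(** By [iter_basis_dist] the sequence is Cauchy, the traces being monotone.
    Coordinatewise limits exist, and bounds on finite partial sums pass to the
    limit, so the limit is square summable and approximates in norm. *)
Lemma iter_basis_limit i : exists y : vec,
  [/\ forall j g, ccvg (fun k => iter k damp (basis_vec i) j g) (y j g),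
      kernel_space y &
      forall e, 0 < e -> exists k,
        l2n_dot (lincomb (-1) y (iter k damp (basis_vec i)))
                (lincomb (-1) y (iter k damp (basis_vec i))) <= e].
Proof.
pose x k := iter k damp (basis_vec i).
have Hx k : l2n (x k) by apply: l2n_iter_damp; exact: l2n_basis.
have coord k l j g : `|x k j g - x l j g| ^+ 2 <= 
    l2n_dot (lincomb (-1) (x k) (x l)) (lincomb (-1) (x k) (x l)).
  have := coord_le_l2n_dot j g (l2n_lincomb (-1) (Hx k) (Hx l)).
  by rewrite /lincomb mulN1r addrC distrC.
have [y ylim] : exists y : vec, forall j g, ccvg (fun k => x k j g) (y j g).
  have /choice[F HF] (p : 'I_n * G) : exists l, ccvg (fun k => x k p.1 p.2) l.
    apply: ccvg_cauchy => e e0; have e20 : 0 < e ^+ 2 / 2 by rewrite divr_gt0 // exprn_gt0.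
    have [K HK] := iter_basis_close e20; exists K => k Kk.
    rewrite -(@ltr_pXn2r _ 2) ?nnegrE // ?(ltW e0) //.
    apply: le_lt_trans (coord K k p.1 p.2) _.
    have [/le_lt_trans H _] := HK K k i (leqnn _) Kk; apply: H.
    by rewrite ltr_pdivrMr // ltr_pMr ?exprn_gt0 // ltr1n.
  by exists (fun j g => F (j, g)) => j g; exact: HF (j, g).
have partial e : 0 < e -> exists k, forall j (J : {fset G}),
    \sum_(g <- J) `|lincomb (-1) y (x k) j g| ^+ 2 <= e.
  move=> e0; have [K HK] := iter_basis_close e0; exists K => j J.
  have lims : ccvg (fun l => \sum_(g <- J) `|x l j g - x K j g| ^+ 2)
                   (\sum_(g <- J) `|y j g - x K j g| ^+ 2).
    apply: ccvg_sum => g; apply: ccvg_norm2.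
    have := ccvg_comb 1 (ylim j g) (ccvg_cst (- x K j g)); rewrite mul1r.
    by congr (ccvg _ _); apply/funext => l; rewrite mul1r.
  under eq_bigr => g _ do rewrite /lincomb mulN1r addrC distrC.
  rewrite -[leLHS]ger0_norm; last by apply: sumr_ge0 => g _; rewrite exprn_ge0.
  apply: (ccvg_le (K := K)) lims _ => l Kl.
  rewrite ger0_norm; last by apply: sumr_ge0 => g _; rewrite exprn_ge0.
  have [H _] := HK K l i (leqnn _) Kl; apply: le_trans H.
  apply: le_trans (l2_dot_le_l2n_dot j (l2n_lincomb (-1) (Hx K) (Hx l))).
  have := l2_dot_ge J (l2n_lincomb (-1) (Hx K) (Hx l) j).
  by under eq_bigr => g _ do rewrite /lincomb mulN1r addrC.
have Hdiff : exists k, l2n (lincomb (-1) y (x k)).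
  have [k Hk] := partial 1 ltr01; exists k => j; apply/l2P; exists 1 => J.
  by under eq_bigr do rewrite ger0_norm ?exprn_ge0 //; exact: Hk.
have Hy : l2n y.
  have [k Hk] := Hdiff; have := l2n_lincomb (-1) Hk (Hx k).
  congr (l2n _); apply/funext => j; apply/funext => g; rewrite /lincomb; ring.
exists y; split=> [//||e e0].
- split=> // j g; apply: (@ccvg_uniq _ (fun k => kop b (x k) j g)).
    apply: ccvg_sum => l; apply: ccvg_sum => t.
    have := ccvg_comb t.1 (ylim l (t.2^-1 * g)%g) (ccvg_cst 0); rewrite addr0.
    by congr (ccvg _ _); apply/funext => k; rewrite addr0.
  move=> e e0; have e20 : 0 < e ^+ 2 / (2 * c) by rewrite divr_gt0 ?mulr_gt0 // exprn_gt0.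
  have [K HK] := iter_basis_close e20; exists K => k Kk.
  rewrite subr0 -(@ltr_pXn2r _ 2) ?nnegrE // ?(ltW e0) //.
  apply: le_lt_trans (coord_le_l2n_dot j g (l2n_kop b (Hx k))) _.
  have [_ /le_lt_trans H] := HK k k i Kk Kk; apply: H.
  have -> : c * (e ^+ 2 / (2 * c)) = e ^+ 2 / 2 by field; rewrite gt_eqF.
  by rewrite ltr_pdivrMr // ltr_pMr ?exprn_gt0 // ltr1n.
have n0 : 0 < n%:R + 1 :> C by rewrite ltr_wpDl.
have [k Hk] := partial _ (divr_gt0 e0 n0); exists k.
have Hyk := l2n_lincomb (-1) Hy (Hx k).
apply: (@le_trans _ _ (\sum_(j < n) e / (n%:R + 1))).
  apply: ler_sum => j _; rewrite -[leLHS]ger0_norm; last exact: l2_dot_ge0 (Hyk j).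
  apply: has_usum_norm_le (l2_dot_has_usum (Hyk j) (Hyk j)) _ => J.
  rewrite ger0_norm; last by apply: sumr_ge0 => g _; exact: mul_conjC_ge0.
  by under eq_bigr do rewrite -normCK; exact: Hk.
rewrite sumr_const card_ord -[leLHS]mulr_natl mulrA ler_pdivrMr // mulrC ler_pM2l //.
by rewrite lerDl.
Qed.


Lemma kernel_space_lincomb a x y :
  kernel_space x -> kernel_space y -> kernel_space (lincomb a x y).
Proof.
move=> [Hx bx] [Hy by0]; split=> [|i g]; first exact: l2n_lincomb.
by rewrite kop_lincomb /lincomb bx by0 mulr0 addr0.
Qed.

Lemma basis_sub_limit_ortho i y v : kernel_space y ->
    (forall e, 0 < e -> exists k,
        l2n_dot (lincomb (-1) y (iter k damp (basis_vec i)))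
                (lincomb (-1) y (iter k damp (basis_vec i))) <= e) ->
  kernel_space v -> l2n_dot (lincomb (-1) y (basis_vec i)) v = 0.
Proof.
move=> [Hy _] ylim Vv; have [Hv _] := Vv; have Hd := l2n_basis i.
apply: eq0_norm_lt => e e0.
have v1 : 0 < l2n_dot v v + 1 by rewrite ltr_wpDl // l2n_dot_ge0.
(* Balances the two terms of [l2n_dot_amgm] so that each is below [e / 2]. *)
pose t := 2 * (l2n_dot v v + 1) / e; have t0 : 0 < t by rewrite divr_gt0 ?mulr_gt0.
have e2t : 0 < e / (2 * t) by apply: divr_gt0 => //; exact: mulr_gt0.
have [k Hk] := ylim _ e2t; have Hx := l2n_iter_damp k Hd.
have -> : l2n_dot (lincomb (-1) y (basis_vec i)) v =
          l2n_dot (lincomb (-1) y (iter k damp (basis_vec i))) v.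
  rewrite !l2n_dotDl //; congr (_ + _).
  by have := iter_damp_dot 0 k Hd Hv; rewrite /= addn0 iter_damp_fix.
apply: le_lt_trans (l2n_dot_amgm t0 (l2n_lincomb _ Hy Hx) Hv) _.
rewrite [e]splitr; apply: ler_ltD.
  have -> : e / 2 = t * (e / (2 * t)) by field; rewrite gt_eqF.
  by rewrite ler_pM2l.
rewrite /t invf_div -mulrA ltr_pM2l // invfM -mulrA.
rewrite -[ltRHS]mulr1 ltr_pM2l ?invr_gt0 //.
by rewrite mulrC ltr_pdivrMr // mul1r ltrDl.
Qed.

(** The limit lies in the kernel, and its difference with the basis vector is
    orthogonal to the kernel because [damp] is self-adjoint and fixes the
    kernel; uniqueness of such a decomposition identifies the projection. *)
Lemma ortho_proj_basis i : exists y : vec,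
  [/\ ortho_proj kernel_space (basis_vec i) = y, kernel_space y,
      forall j g, ccvg (fun k => iter k damp (basis_vec i) j g) (y j g) &
      forall v, kernel_space v -> l2n_dot (basis_vec i) v = l2n_dot y v].
Proof.
have [y [ylim Vy ydist]] := iter_basis_limit i; exists y.
have Hd := l2n_basis i.
have eqd z v : kernel_space z -> kernel_space v ->
    l2n_dot (fun j g => basis_vec i j g - z j g) v =
    l2n_dot (basis_vec i) v - l2n_dot z v.
  move=> [Hz _] [Hv _]; rewrite addrC -mulN1r -l2n_dotDl //; congr l2n_dot.
  by apply/funext => j; apply/funext => g; rewrite /lincomb mulN1r addrC.
have orth v : kernel_space v -> l2n_dot (basis_vec i) v = l2n_dot y v.
  move=> Vv; have := basis_sub_limit_ortho Vy ydist Vv.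
  case: (Vy) (Vv) => Hy _ [Hv _]; rewrite l2n_dotDl // mulN1r addrC => /eqP.
  by rewrite subr_eq0 => /eqP.
split=> //; apply: xget_unique.
  by split=> // v Vv; rewrite eqd // orth // subrr.
move=> z [Vz Hz].
have Vd := kernel_space_lincomb (-1) Vz Vy.
have := Hz _ Vd; rewrite eqd // orth // => d0.
have dd : l2n_dot (lincomb (-1) z y) (lincomb (-1) z y) = 0.
  by case: (Vz) (Vy) (Vd) => Hz' _ [Hy _] [Hd' _]; rewrite l2n_dotDl // mulN1r addrC.
apply/funext => j; apply/funext => g.
have := l2n_dot_eq0 (proj1 Vd) dd j g; rewrite /lincomb mulN1r addrC => /eqP.
by rewrite subr_eq0 => /eqP ->.
Qed.

Lemma vN_dim_lim : ccvg trace_pow (vN_dim kernel_space).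
Proof.
apply: ccvg_sum => i; rewrite /vN_trace /op_entry -/(basis_vec i).
have [y [-> [Hy _] ylim _]] := ortho_proj_basis i.
by rewrite l2_delta_dot; [exact: ylim | exact: Hy].
Qed.

Lemma kernel_space_shift h x :
  kernel_space x -> kernel_space (fun i g => x i (g * h)%g).
Proof.
move=> [Hx bx]; split=> [i|i g].
  by apply: (l2_shift (mulgK h)); exact: Hx.
rewrite -[RHS](bx i (g * h)%g); apply: eq_bigr => j _; apply: eq_bigr => t _.
by rewrite mulgA.
Qed.

(** Faithfulness of the trace. If the dimension is 0, so is the squared norm of
    each projected basis vector; the kernel is then orthogonal to the basis
    vectors, hence, being invariant under right translation, zero. *)
Lemma vN_dim_eq0 : vN_dim kernel_space = 0 <->
  forall x, kernel_space x -> forall i g, x i g = 0.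
Proof.
have E i : exists y : vec, [/\ kernel_space y,
    vN_trace (op_entry (ortho_proj kernel_space) i i) = l2n_dot y y &
    forall v, kernel_space v -> l2n_dot (basis_vec i) v = l2n_dot y v].
  have [y [yE Vy _ orth]] := ortho_proj_basis i; have [Hy _] := Vy; exists y; split=> //.
  rewrite /vN_trace /op_entry -/(basis_vec i) yE l2_delta_dot; last exact: Hy.
  rewrite -l2n_dot_basis // (l2n_dotC (l2n_basis i) Hy) orth //.
  by rewrite -l2n_dotC.
split=> [dim0 x Vx i g|V0].
  have ge0 j : 0 <= vN_trace (op_entry (ortho_proj kernel_space) j j).
    by have [y [[Hy _] -> _]] := E j; exact: l2n_dot_ge0.
  have tr0 : vN_trace (op_entry (ortho_proj kernel_space) i i) = 0.
    apply/eqP; move/eqP: dim0; rewrite psumr_eq0 => [/allP/(_ i)|j _] //.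
    by rewrite mem_index_enum => /(_ isT).
  have [y [[Hy _] yE orth]] := E i.
  have y0 := l2n_dot_eq0 Hy (etrans (esym yE) tr0).
  have := orth _ (kernel_space_shift g Vx).
  have -> : y = fun _ _ => 0 by apply/funext => j; apply/funext => h; exact: y0.
  have [Hs _] := kernel_space_shift g Vx.
  rewrite (l2n_dotC Hs (l2n_basis i)) l2n_dot_basis // mul1g.
  rewrite /l2n_dot big1 => [/eqP|j _]; last by rewrite l2_dot0l.
  by rewrite conjC_eq0 => /eqP.
apply: big1 => i _; have [y [Vy -> _]] := E i.
have -> : y = fun _ _ => 0 by apply/funext => j; apply/funext => h; exact: V0.
by rewrite /l2n_dot big1 // => j _; rewrite l2_dot0l.
Qed.

End KernelProjection.

(** * Finite models of a matrix over the group ring *)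

Section BlockNorm.
Local Open Scope sesquilinear_scope.
Context {C : numClosedFieldType} {n m : nat}.

Lemma nsq_mxrow (U : 'I_n -> 'rV[C]_m) :
  nsq (\mxrow_(i < n) U i) = \sum_i nsq (U i).
Proof.
rewrite nsqE tr_mxrow.
have -> : map_mx Num.conj (\mxcol_(i < n) (U i)^T) = \mxcol_(i < n) (U i) ^t*.
  by apply/matrixP => i j; rewrite !mxE.
rewrite mul_mxrow_mxcol summxE; apply: eq_bigr => i _; exact/esym/nsqE.
Qed.

Lemma nsq_sum_le k (I : Type) (r : seq I) (F : I -> 'rV[C]_k) :
  nsq (\sum_(i <- r) F i) <= 2 ^+ size r * \sum_(i <- r) nsq (F i).
Proof.
elim: r => [|i r IHr].
  by rewrite !big_nil mulr0 /nsq big1 // => j _; rewrite mxE normr0 expr0n.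
rewrite !big_cons; apply: le_trans (nsqD_le _ _) _.
rewrite /= exprS -mulrA ler_wpM2l // mulrDr lerD //.
by rewrite ler_peMl ?nsq_ge0 // exprn_ege1 // ler1n.
Qed.

Lemma nsq_perm (u : 'rV[C]_m) s : nsq (u *m perm_mx s) = nsq u.
Proof.
apply: nsq_unitary; apply/unitarymxP.
by rewrite tr_perm_mx map_perm_mx -perm_mxM mulgV perm_mx1.
Qed.

Lemma sqbounded_mxblock (B : 'I_n -> 'I_n -> 'M[C]_m) (k : 'I_n -> 'I_n -> C) :
    (forall i j, sqbounded (k i j) (B i j)) -> (forall i j, 0 <= k i j) ->
  sqbounded (2 ^+ n * \sum_i \sum_j k i j) (\mxblock_(i < n, j < n) B i j).
Proof.
move=> HB k0 u; rewrite -[u]submxrowK; set U := submxrow u.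
rewrite mul_mxrow_mxblock !nsq_mxrow -mulrA.
apply: (@le_trans _ _ (\sum_j 2 ^+ n * \sum_i k i j * nsq (U i))).
  apply: ler_sum => j _; apply: le_trans (nsq_sum_le _ _) _.
  have -> : size (index_enum 'I_n) = n by rewrite -sum1_size sum1_card card_ord.
  rewrite ler_wpM2l ?exprn_ge0 //.
  by apply: ler_sum => i _; exact: HB.
rewrite -mulr_sumr ler_wpM2l ?exprn_ge0 // exchange_big /= mulr_suml.
apply: ler_sum => i _; rewrite mulr_suml; apply: ler_sum => j _.
by rewrite ler_wpM2l // (bigD1 i) //= lerDl sumr_ge0 // => l _; exact: nsq_ge0.
Qed.

End BlockNorm.

Section FiniteKernel.
Local Open Scope sesquilinear_scope.
Context {R : realType} {G : groupType} {n : nat}.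
Local Notation C := R[i].
Variables (m : nat) (phi : G -> 'S_m).

Definition kmx (b : @grmx R G n) : 'M[C]_(\sum_(i < n) m) :=
  \mxblock_(i < n, j < n) \sum_(t <- b i j) t.1 *: perm_mx (phi t.2).

Lemma kmx_adj b : (forall i j t, t \in b i j -> phi t.2^-1%g = (phi t.2)^-1%g) ->
  kmx (kadj b) = (kmx b) ^t*.
Proof.
move=> phiV; rewrite /kmx tr_mxblock.
have -> : map_mx Num.conj
      (\mxblock_(i < n, j < n) (\sum_(t <- b j i) t.1 *: perm_mx (phi t.2))^T)
  = \mxblock_(i < n, j < n) 
      map_mx Num.conj (\sum_(t <- b j i) t.1 *: perm_mx (phi t.2) : 'M[C]_m)^T.
  by apply/matrixP => i j; rewrite !mxE.
apply: eq_mxblock => i j; rewrite /kadj big_map raddf_sum /= raddf_sum /=.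
rewrite !big_seq; apply: eq_bigr => t tb.
by rewrite linearZ /= map_mxZ tr_perm_mx map_perm_mx (phiV _ _ _ tb).
Qed.

Definition grmx_bound (b : @grmx R G n) : C :=
  2 ^+ n * \sum_i \sum_j 2 ^+ size (b i j) * \sum_(t <- b i j) `|t.1| ^+ 2.

Lemma grmx_bound_ge0 b : 0 <= grmx_bound b.
Proof.
rewrite mulr_ge0 ?exprn_ge0 // sumr_ge0 // => i _; rewrite sumr_ge0 // => j _.
by rewrite mulr_ge0 ?exprn_ge0 // sumr_ge0 // => t _; rewrite exprn_ge0.
Qed.

Lemma sqbounded_kmx b : sqbounded (grmx_bound b) (kmx b).
Proof.
apply: sqbounded_mxblock => [i j u|i j]; last first.
  by rewrite mulr_ge0 ?exprn_ge0 // sumr_ge0 // => t _; rewrite exprn_ge0.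
rewrite mulmx_sumr; apply: le_trans (nsq_sum_le _ _) _.
rewrite -mulrA ler_wpM2l ?exprn_ge0 // mulr_suml; apply: ler_sum => t _.
by rewrite -scalemxAr nsqZ nsq_perm.
Qed.

(** In the graph on ['I_m] that the permutations [phi g] define, the vertex [v]
    looks like the unit of the group up to the part [F]. *)
Definition good_vertex (F : {fset G}) (v : 'I_m) : Prop :=
  (forall h g, h \in F -> g \in F ->
     forall u, (phi g (phi h u) == v) = (phi (h * g)%g u == v)) /\
  (forall g, g \in F -> g != 1%g -> phi g v != v).

Definition transport (F : {fset G}) (v : 'I_m) (x : 'I_n -> G -> C) :
    'cV[C]_(\sum_(i < n) m) :=
  \mxcol_(i < n) \col_(u < m) \sum_(g <- F) x i g * (phi g u == v)%:R.

Definition supported (F : {fset G}) (x : 'I_n -> G -> C) : Prop :=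
  forall i g, g \notin F -> x i g = 0.

(** Each term of [b] permutes the vertices seen from [v] as it translates [F0],
    so the finite model of [b] acts on transported vectors as [b] does. *)
Lemma transport_kop F F0 v b x : good_vertex F v -> supported F0 x ->
    (F0 `<=` F)%fset ->
    (forall i j t, t \in b i j -> t.2 \in F) ->
    (forall i j t g, t \in b i j -> g \in F0 -> (t.2 * g)%g \in F) ->
  kmx b *m transport F v x = transport F v (kop b x).
Proof.
move=> [vmul _] xF0 F0F bF bF0; rewrite /kmx /transport mul_mxblock_mxrow.
apply: eq_mxcol => i; apply/colP => u; rewrite summxE mxE.
transitivity (\sum_j \sum_(t <- b i j) \sum_(g <- F)
    t.1 * x j (t.2^-1 * g)%g * (phi g u == v)%:R); last first.
  under [RHS]eq_bigr => g _ do rewrite /kop mulr_suml.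
  rewrite [RHS]exchange_big /=; apply: eq_bigr => j _.
  under [RHS]eq_bigr => g _ do rewrite mulr_suml.
  by rewrite [RHS]exchange_big.
apply: eq_bigr => j _; rewrite mulmx_suml summxE !big_seq; apply: eq_bigr => t tb.
rewrite -scalemxAl mxE.
have -> : (perm_mx (phi t.2) *m \col_u0 \sum_(g <- F) x j g * (phi g u0 == v)%:R) u 0
   = \sum_(g <- F) x j g * (phi g (phi t.2 u) == v)%:R :> C.
  rewrite mxE (bigD1 (phi t.2 u)) //= big1 => [|w wu].
    by rewrite !mxE eqxx mul1r addr0.
  by rewrite !mxE eq_sym (negbTE wu) mul0r.
rewrite mulr_sumr.
transitivity (\sum_(g <- F0) t.1 * (x j g * (phi (t.2 * g)%g u == v)%:R)).
  rewrite -(big_fset_incl _ F0F); last by move=> g _ /xF0 ->; rewrite mul0r mulr0.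
  rewrite !big_seq; apply: eq_bigr => g gF0.
  by rewrite (vmul _ _ (bF _ _ _ tb) (fsubsetP F0F _ gF0)).
have hF : ([fset t.2 * g | g in F0]%g `<=` F)%fset.
  by apply/fsubsetP => _ /imfsetP[g gF0 ->]; exact: bF0 tb gF0.
rewrite -(big_fset_incl _ hF) => [|g _ gF0]; last first.
  rewrite (xF0 j) ?mulr0 ?mul0r //; apply: contra gF0 => gF0.
  by apply/imfsetP; exists (t.2^-1 * g)%g; rewrite ?mulKVg.
rewrite sum_fset_image; last exact: mulgI.
by apply: eq_bigr => g _; rewrite mulKg mulrA.
Qed.

Lemma transport_lincomb F v a x y :
  transport F v (lincomb a x y) = a *: transport F v x + transport F v y.
Proof.
pose T (z : 'I_n -> G -> C) i : 'cV[C]_m := \col_u \sum_(g <- F) z i g * (phi g u == v)%:R.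
rewrite /transport; apply/mxcolP => i; rewrite submxcolD mxcolK.
have -> : submxcol (a *: \mxcol_(i < n) T x i) i = a *: T x i.
  by rewrite -(mxcolK (T x) i); apply/matrixP => ? ?; rewrite !mxE.
rewrite mxcolK; apply/colP => u; rewrite !mxE mulr_sumr -big_split /=.
by apply: eq_bigr => g _; rewrite /lincomb mulrDl mulrA.
Qed.

End FiniteKernel.

(** * Traces at good vertices *)

Section Balls.
Local Open Scope sesquilinear_scope.
Context {R : realType} {G : groupType} {n : nat}.
Local Notation C := R[i].
Variables (b : @grmx R G n) (E : {fset G}).
Hypothesis E1 : 1%g \in E.
Hypothesis Eb : forall i j t, t \in b i j -> t.2 \in E /\ t.2^-1%g \in E.

Definition wball k : {fset G} :=
  iter k (fun F : {fset G} => [fset (h * g)%g | h in E, g in F]%fset) [fset 1%g]%fset.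

Lemma mem_wballS k h g : h \in E -> g \in wball k -> (h * g)%g \in wball k.+1.
Proof. by move=> hE gk; apply/imfset2P; exists h => //; exists g. Qed.

Lemma wball_subS k : (wball k `<=` wball k.+1)%fset.
Proof. by apply/fsubsetP => g gk; rewrite -[g]mul1g mem_wballS. Qed.

Lemma wball_sub k l : (k <= l)%N -> (wball k `<=` wball l)%fset.
Proof.
move=> /subnK <-; elim: (l - k)%N => [|d IHd]; first exact: fsubset_refl.
by apply: fsubset_trans IHd _; rewrite addSn; exact: wball_subS.
Qed.

Lemma E_sub_wball1 : (E `<=` wball 1)%fset.
Proof.
by apply/fsubsetP => h hE; rewrite -[h]mulg1 mem_wballS //= inE.
Qed.

Lemma kadj_E i j t : t \in kadj b i j -> t.2 \in E.
Proof. by move=> /mapP[s sb ->] /=; have [] := Eb sb. Qed.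

Lemma supported_kop (a : @grmx R G n) k x :
    (forall i j t, t \in a i j -> t.2 \in E) ->
  supported (wball k) x -> supported (wball k.+1) (kop a x).
Proof.
move=> aE xk i g gk; rewrite /kop big1 // => j _; rewrite big_seq big1 // => t ta.
rewrite (xk j) ?mulr0 //; apply: contra gk => gk.
by rewrite -[g](mulKVg t.2) mem_wballS ?(aE _ _ _ ta).
Qed.

Lemma b_E i j t : t \in b i j -> t.2 \in E.
Proof. by move=> /Eb[]. Qed.

Lemma supported_iter_damp c k i :
  supported (wball k.*2) (iter k (damp b c) (basis_vec i)).
Proof.
elim: k => [|k IHk] j g gk /=.
  rewrite /basis_vec /l2n_inj /delta; case: (j == i) => //.
  by move: gk; rewrite /= inE => /negbTE ->.
rewrite /damp /lincomb.
have H1 := supported_kop b_E IHk; have H2 := supported_kop kadj_E H1.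
rewrite (H2 j g gk) mulr0 add0r; apply: IHk; apply: contra gk.
by apply: (fsubsetP (wball_sub _)); rewrite doubleS -addn2 leq_addr.
Qed.

Variables (c : C) (m : nat) (phi : G -> 'S_m) (F : {fset G}) (K : nat).
Hypothesis F_ball : (wball K.*2.+1 `<=` F)%fset.
Hypothesis phi1 : phi 1%g = 1%g.
Hypothesis phiV : forall g, g \in F -> phi g^-1%g = (phi g)^-1%g.

Let X := (kmx phi b) ^t*.
Let T := 1%:M - c^-1 *: (X *m X ^t*).

Lemma wball_F k : (k <= K.*2.+1)%N -> (wball k `<=` F)%fset.
Proof. by move=> kK; apply: fsubset_trans (wball_sub kK) F_ball. Qed.

Lemma E_F h : h \in E -> h \in F.
Proof.
by move=> hE; apply: (fsubsetP (wball_F (ltn0Sn _))); exact: (fsubsetP E_sub_wball1).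
Qed.

Lemma one_F : 1%g \in F.
Proof. exact: E_F. Qed.

Lemma gram_kmx : X *m X ^t* = kmx phi (kadj b) *m kmx phi b.
Proof.
by rewrite /X trmxCK kmx_adj // => i j t /b_E tE; apply/phiV/E_F.
Qed.

Lemma transport_iter v i k : good_vertex phi F v -> (k <= K)%N ->
  iter k (mulmx T) 1%:M *m transport phi F v (basis_vec i) =
  transport phi F v (iter k (damp b c) (basis_vec i)).
Proof.
move=> vF; elim: k => [|k IHk] kK /=; first by rewrite mul1mx.
rewrite -mulmxA IHk ?(ltnW kK) //.
have xk : supported (wball k.*2) (iter k (damp b c) (basis_vec i)).
  exact: supported_iter_damp.
have kK2 : (k.*2.+2 <= K.*2)%N by rewrite -doubleS leq_double.
have mulF j h g : (j <= k.*2.+1)%N -> h \in E -> g \in wball j -> (h * g)%g \in F.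
  move=> jk hE gj; apply: (fsubsetP (wball_F _)) (mem_wballS hE gj).
  by apply: leq_trans (leqnSn _); apply: leq_trans kK2; rewrite ltnS.
rewrite /T gram_kmx mulmxBl mul1mx -scalemxAl -mulmxA.
rewrite (transport_kop vF xk); first last.
- by move=> ? ? t g /b_E tE gk; apply: mulF gk.
- by move=> ? ? t /b_E; exact: E_F.
- by apply: wball_F; apply: leq_trans (leqnSn _); rewrite leq_double ltnW.
have bxk := supported_kop b_E xk.
rewrite (transport_kop vF bxk); first last.
- by move=> ? ? t g /kadj_E tE gk; apply: mulF gk.
- by move=> ? ? t /kadj_E; exact: E_F.
- by apply: wball_F; apply: leq_trans (leqnSn _); apply: leq_trans kK2.
by rewrite /damp transport_lincomb scaleNr addrC.
Qed.

Lemma transport_basis v i : transport phi F v (basis_vec i) =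
  \mxcol_(j < n) (if j == i then delta_mx v 0 else 0 : 'cV[C]_m).
Proof.
apply: eq_mxcol => j; apply/colP => u; rewrite mxE.
rewrite (big_fsetD1 _ one_F) /= big_seq big1 => [|g].
  rewrite addr0 phi1 perm1 /basis_vec /l2n_inj /delta eqxx.
  by case: (j == i); rewrite !mxE ?mul0r // mul1r andbT.
rewrite !inE => /andP[g1 _].
by rewrite /basis_vec /l2n_inj /delta (negbTE g1); case: (j == i); rewrite mul0r.
Qed.

Lemma submxcol_mul_delta (Z : 'M[C]_(\sum_(i < n) m)) (i : 'I_n) (v : 'I_m) :
  submxcol (Z *m \mxcol_(j < n) (if j == i then delta_mx v 0 else 0 : 'cV[C]_m)) i v 0 =
  submxblock Z i i v v.
Proof.
rewrite -{1}[Z]submxblockK mul_mxblock_mxrow mxcolK summxE.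
rewrite (bigD1 i) //= eqxx big1 => [|j ji]; last first.
  by rewrite (negbTE ji) mulmx0 mxE.
rewrite addr0 mxE (bigD1 v) //= big1 => [|w wv].
  by rewrite !mxE !eqxx mulr1 addr0.
by rewrite !mxE (negbTE wv) mulr0.
Qed.

Lemma diag_entry v i k : good_vertex phi F v -> (k <= K)%N ->
  submxblock (iter k (mulmx T) 1%:M) i i v v = iter k (damp b c) (basis_vec i) i 1%g.
Proof.
move=> vF kK; have := transport_iter i vF kK; rewrite transport_basis.
move=> /(congr1 (fun M => submxcol M i v 0)); rewrite submxcol_mul_delta.
rewrite /transport mxcolK => ->; rewrite mxE (big_fsetD1 _ one_F) /= phi1 perm1 eqxx.
rewrite mulr1 big_seq big1 ?addr0 // => g; rewrite !inE => /andP[g1 gF].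
by rewrite (negbTE (proj2 vF g gF g1)) mulr0.
Qed.

Definition bad_vertices : {set 'I_m} := [set v | ~~ `[< good_vertex phi F v >]]%SET.

(** Good vertices contribute to both traces equally. At the other vertices a
    diagonal entry of a positive contraction lies between 0 and 1. *)
Lemma trace_estimate k : 0 < c -> sqbounded c X -> (k <= K)%N ->
  `|\tr (iter k (mulmx T) 1%:M) - m%:R * trace_pow b c k| <=
  #|bad_vertices|%:R *
    \sum_i (1 + `|iter k (damp b c) (@basis_vec R G n i) i 1%g|).
Proof.
move=> c0 Xc kK; set Z := iter k _ _.
have -> : \tr Z = \sum_(v < m) \sum_i submxblock Z i i v v.
  rewrite -{1}[Z]submxblockK mxtrace_mxblock exchange_big /=.
  by apply: eq_bigr => i _.
have -> : m%:R * trace_pow b c k = \sum_(v < m) trace_pow b c k.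
  by rewrite sumr_const card_ord mulr_natl.
rewrite -sumrB (bigID [in bad_vertices]) /= [X in _ + X]big1 => [|v]; last first.
  rewrite inE negbK => /asboolP vF; rewrite /trace_pow -sumrB big1 // => i _.
  by rewrite diag_entry // subrr.
rewrite addr0; apply: le_trans (ler_norm_sum _ _ _) _.
rewrite mulr_natl -sumr_const; apply: ler_sum => v _.
rewrite /trace_pow -sumrB; apply: le_trans (ler_norm_sum _ _ _) _.
apply: ler_sum => i _; apply: le_trans (ler_normB _ _) _; rewrite lerD2r.
rewrite mxE; have /andP[ge0 le1] := iter_gram_diag_itv c0 Xc k (tagnat.Rank i v).
by rewrite ger0_norm.
Qed.

End Balls.

Section CountBad.
Context {R : realType} {G : groupType}.
Variables (m : nat) (phi : G -> 'S_m) (F : {fset G}) (F' : {fset G}) (eps : R).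
Hypothesis approx : sofic_approx F' eps phi.
Hypothesis FF' : (F `<=` F')%fset.
Hypothesis eps_ge0 : 0 <= eps.

Lemma sumr_fset_const (x : R) : \sum_(h <- F) x = #|` F|%:R * x.
Proof. by rewrite big_const_seq count_predT iter_addr_0 mulr_natl. Qed.

(** A vertex is bad because of one of the relations [h * g] or of one fixed
    point, and each of these fails at no more than [eps * m] vertices. *)
Lemma card_bad_vertices :
  #|bad_vertices phi F|%:R <= (#|` F| ^ 2 + #|` F|)%:R * (eps * m%:R) :> R.
Proof.
have [m0 mulP _ freeP] := approx.
pose D h g := [set v : 'I_m | [exists u, (phi g (phi h u) == v) != (phi (h * g)%g u == v)]]%SET.
pose Fx g := [set v : 'I_m | phi g v == v]%SET.
have cD h g : h \in F -> g \in F -> #|D h g|%:R <= eps * m%:R :> R.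
  move=> hF gF.
  have := mulP h g (fsubsetP FF' _ hF) (fsubsetP FF' _ gF).
  set s := (phi h * phi g)%g; set t := phi (h * g)%g => nf.
  have le : (nfix (s * t^-1)%g + #|D h g| <= m)%N.
    rewrite -[X in (_ <= X)%N]card_ord -(cardsC (D h g)) addnC leq_add2l /nfix.
    rewrite -(card_imset _ (@perm_inj _ t)); apply: subset_leq_card.
    apply/fintype.subsetP => _ /imsetP[i + ->]; rewrite !inE permM => /eqP si.
    have {}si : s i = t i by rewrite -[s i](permKV t) si.
    rewrite negb_exists; apply/forallP => u; rewrite negbK.
    by rewrite -permM -/s -/t -{1}si !(inj_eq perm_inj).
  have {}le : (nfix (s * t^-1)%g)%:R + #|D h g|%:R <= m%:R :> R by rewrite -natrD ler_nat.
  by move: nf le; rewrite mulrBl mul1r; move: (_%:R) (_%:R) (eps * _) => a d e; lra.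
have cover v : ((v \in bad_vertices phi F) <=
    \sum_(h <- F) \sum_(g <- F) (v \in D h g) + \sum_(g <- F | g != 1%g) (v \in Fx g))%N.
  rewrite inE; case: asboolP => //= nvF; rewrite lt0n; apply/negP.
  rewrite addn_eq0 !sum_nat_seq_eq0 => /andP[/allP D0 /allP F0]; apply: nvF; split.
    move=> h g hF gF u; have := D0 h hF; rewrite /= sum_nat_seq_eq0 => /allP/(_ g gF) /=.
    by rewrite eqb0 inE negb_exists => /forallP/(_ u); rewrite negbK => /eqP.
  by move=> g gF g1; have := F0 g gF; rewrite g1 /= eqb0 inE.
have : (#|bad_vertices phi F| <=
    \sum_(h <- F) \sum_(g <- F) #|D h g| + \sum_(g <- F | g != 1%g) #|Fx g|)%N.
  have cE (A : {set 'I_m}) : #|A| = (\sum_v (v \in A))%N by rewrite -sum1_card big_mkcond.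
  rewrite cE; apply: leq_trans.
    by apply: leq_sum => v _; exact: cover.
  rewrite big_split /= leq_add //.
    rewrite exchange_big /=; apply: leq_sum => h _; rewrite exchange_big /=.
    by apply: leq_sum => g _; rewrite -cE.
  by rewrite exchange_big /=; apply: leq_sum => g _; rewrite -cE.
rewrite -(ler_nat R) => /le_trans; apply.
rewrite natrD [in leRHS]natrD mulrDl; apply: lerD.
  rewrite natr_sum -mulnn natrM -mulrA -2!sumr_fset_const.
  rewrite !big_seq; apply: ler_sum => h hF; rewrite natr_sum.
  by rewrite !big_seq; apply: ler_sum => g gF; exact: cD.
rewrite natr_sum -sumr_fset_const big_mkcond /= !big_seq; apply: ler_sum => g gF.
case: ifP => g1; first exact: freeP (fsubsetP FF' _ gF) g1.
by rewrite mulr_ge0.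
Qed.

End CountBad.

(** * The directed set of sofic approximations *)

Section SoficIndex.
Context {R : realType} {G : groupType}.

Lemma symmetric_closure (F : {fset G}) :
  ([fset g^-1%g | g in F `|` [fset g^-1%g | g in F]] == F `|` [fset g^-1%g | g in F])%fset.
Proof.
apply/eqP/fsetP => g; apply/imfsetP/idP => [[h /= + ->]|].
  rewrite !inE => /orP[hF|/imfsetP[h' /= hF ->]]; last by rewrite invgK hF.
  by apply/orP; right; apply/imfsetP; exists h.
rewrite inE => /orP[gF|/imfsetP[h /= hF ->]]; last by exists h; rewrite // inE hF.
exists g^-1%g; rewrite ?invgK // inE; apply/orP; right.
by apply/imfsetP; exists g.
Qed.

Lemma exists_sofic_index (F : {fset G}) (r : R) : 0 < r ->
  exists p : sofic_index R G, (F `<=` idx_set p)%fset /\ idx_eps p <= r.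
Proof.
move=> r0.
have bd : 0 < Num.min r (2^-1 : R) < 1.
  by rewrite lt_min r0 invr_gt0 ltr0n /= gt_min invf_lt1 ?ltr1n ?orbT.
exists (SoficIndex (symmetric_closure F) bd) => /=.
by rewrite fsubsetUl ge_min lexx.
Qed.

Lemma sofic_index_join (p q : sofic_index R G) :
  exists s, sofic_index_le p s /\ sofic_index_le q s.
Proof.
have r0 : 0 < Num.min (idx_eps p) (idx_eps q).
  rewrite lt_min; have /andP[-> _] := idx_eps_bounds p.
  by have /andP[-> _] := idx_eps_bounds q.
have [s [sF sr]] := exists_sofic_index (idx_set p `|` idx_set q)%fset r0.
move: sF; rewrite fsubUset => /andP[pF qF]; move: sr; rewrite le_min => /andP[pr qr].
by exists s; rewrite /sofic_index_le pF qF.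
Qed.

Lemma sofic_index_le_trans (q p s : sofic_index R G) :
  sofic_index_le p q -> sofic_index_le q s -> sofic_index_le p s.
Proof.
move=> /andP[pq qp] /andP[qs sq]; apply/andP; split.
  exact: fsubset_trans pq qs.
exact: le_trans sq qp.
Qed.

Lemma sofic_index_le_refl (p : sofic_index R G) : sofic_index_le p p.
Proof. by rewrite /sofic_index_le fsubset_refl lexx. Qed.

Lemma sofic_limit_filter : ProperFilter (@sofic_limit R G).
Proof.
apply: filter_from_proper => [|p _]; last by exists p; exact: sofic_index_le_refl.
apply: filter_fromT_filter.
  by have [p _] := exists_sofic_index fset0 (ltr01 : 0 < 1 :> R); exists p.
move=> p q; have [s [ps qs]] := sofic_index_join p q; exists s => t /= st.
by split; apply: sofic_index_le_trans st.
Qed.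

End SoficIndex.

(** * The approximation formula *)

Section Approximation.
Local Open Scope sesquilinear_scope.
Context {R : realType} {G : groupType} {n : nat}.
Local Notation C := R[i].
Variables (A : 'M[gring G int]_n) (m : sofic_index R G -> nat)
  (phi : forall p : sofic_index R G, G -> 'S_(m p)).
Hypothesis phi_sofic : sofic_family phi.
Variable lam : C.
Local Notation AC := (map_mx (gring_map intr) A : 'M[gring G C]_n).

Definition shift_grmx : @grmx R G n := fun i j =>
  (if i == j then [:: (lam, 1%g)] else [::]) ++
  [seq (- AC i j h, h) | h <- finsupp (AC i j)].

Lemma kop_shift_grmx x i g :
  kop shift_grmx x i g = lam * x i g - mxconv AC x i g.
Proof.
rewrite /kop /shift_grmx; under eq_bigr => j _ do rewrite big_cat /= big_map.
rewrite big_split /=; congr (_ + _).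
  rewrite (bigD1 i) //= eqxx big_seq1 invg1 mul1g big1 ?addr0 // => j ji.
  by rewrite eq_sym (negbTE ji) big_nil.
rewrite /mxconv -sumrN; apply: eq_bigr => j _; rewrite /lconv -sumrN.
by apply: eq_bigr => h _; rewrite mulNr.
Qed.

Lemma kernel_space_shift_grmx : kernel_space shift_grmx = l2_eigenspace AC lam.
Proof.
by apply/seteqP; split=> x [Hx x0]; split=> // i g; have := x0 i g;
  rewrite kop_shift_grmx.
Qed.

Lemma kmx_shift_grmx k (s : G -> 'S_k) : s 1%g = 1%g ->
  kmx s shift_grmx = lam%:M - perm_lin_mx s AC.
Proof.
move=> s1; rewrite -(mxdiagZ lam) /mxdiag /perm_lin_mx -mxblockB /kmx.
apply: eq_mxblock => i j; rewrite /shift_grmx big_cat /= big_map; congr (_ + _).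
  case: (i == j); last by rewrite big_nil.
  by rewrite big_seq1 /= s1 perm_mx1 conform_mx_id scalemx1.
by rewrite /perm_lin -sumrN; apply: eq_bigr => h _; rewrite scaleNr.
Qed.

Definition int_perm_mx k (s : G -> 'S_k) : 'M[int]_(\sum_(i < n) k) :=
  \mxblock_(i < n, j < n) \sum_(g <- finsupp (A i j)) A i j g *: perm_mx (s g).

Lemma perm_lin_mx_int k (s : G -> 'S_k) :
  perm_lin_mx s AC = map_mx intr (int_perm_mx s).
Proof.
have -> : map_mx intr (int_perm_mx s) = \mxblock_(i < n, j < n)
    map_mx intr (\sum_(g <- finsupp (A i j)) A i j g *: perm_mx (s g)) :> 'M[C]__.
  by apply/matrixP => i j; rewrite !mxE.
apply: eq_mxblock => i j; rewrite raddf_sum /perm_lin mxE.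
have sub : (finsupp (gring_map (intr : int -> C) (A i j)) `<=` finsupp (A i j))%fset.
  apply/fsubsetP => g; rewrite !mem_finsupp /gring_map fsfunE mem_finsupp.
  by case: (A i j g != 0); rewrite ?eqxx.
have E g : gring_map (intr : int -> C) (A i j) g = (A i j g)%:~R.
  by rewrite /gring_map fsfunE mem_finsupp; case: eqP => // ->.
rewrite (big_fset_incl _ sub) => [|g _]; last first.
  by rewrite memNfinsupp => /eqP ->; rewrite scale0r.
apply: eq_bigr => g _; rewrite E; apply/matrixP => u v.
by rewrite !mxE /= intrM mulrz_nat.
Qed.

Let b := shift_grmx.
Let c : C := grmx_bound (kadj b) + 1.

Let c_ge1 : 1 <= c. Proof. by rewrite lerDr grmx_bound_ge0. Qed.
Let c_gt0 : 0 < c. Proof. exact: lt_le_trans c_ge1. Qed.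

Let E : {fset G} := [fset g | g in
  1%g :: [seq t.2 | t <- flatten [seq b ij.1 ij.2 | ij <- enum {: 'I_n * 'I_n}]]
  ++ [seq t.2^-1%g | t <- flatten [seq b ij.1 ij.2 | ij <- enum {: 'I_n * 'I_n}]]]%fset.

Let E1 : 1%g \in E.
Proof. by apply/imfsetP; exists 1%g => //=; rewrite mem_head. Qed.

Let Eb i j t : t \in b i j -> t.2 \in E /\ t.2^-1%g \in E.
Proof.
move=> tb.
have tin : t \in flatten [seq b ij.1 ij.2 | ij <- enum {: 'I_n * 'I_n}].
  by apply/flattenP; exists (b i j) => //; apply/mapP; exists (i, j); rewrite ?mem_enum.
split; apply/imfsetP; [exists t.2 | exists t.2^-1%g] => //=.
  by rewrite in_cons mem_cat (map_f (fun t : C * G => t.2) tin) orbT.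
by rewrite in_cons mem_cat (map_f (fun t : C * G => t.2^-1%g) tin) !orbT.
Qed.

Let X p := (kmx (phi p) b) ^t*.
Let T p := 1%:M - c^-1 *: (X p *m X p ^t*).
Let tr p k : C := \tr (iter k (mulmx (T p)) 1%:M).

Let phi1 p : phi p 1%g = 1%g. Proof. by have [[]] := phi_sofic p. Qed.
Let m_gt0 p : 0 < (m p)%:R :> C.
Proof. by have [[m0 _ _ _] _] := phi_sofic p; rewrite ltr0n. Qed.

Let near_trace k e : 0 < e ->
  \forall p \near @sofic_limit R G,
    sqbounded c (X p) /\ `|tr p k / (m p)%:R - trace_pow b c k| < e.
Proof.
move=> /pos_complexP[r r0 ->].
pose F := wball E k.*2.+1.
pose S : C := \sum_i (1 + `|iter k (damp b c) (@basis_vec R G n i) i 1%g|).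
have S0 : 0 <= S by apply: sumr_ge0 => i _; rewrite addr_ge0.
have [S' S'E] : exists S' : R, S = S'%:C%C.
  by exists (complex.Re S); rewrite RRe_real // ger0_real.
have S'0 : 0 <= S' by rewrite -ler0c -S'E.
pose Q : R := (#|` F| ^ 2 + #|` F|)%:R.
have Q0 : 0 <= Q by rewrite ler0n.
have QS : 0 < Q * S' + 1 by rewrite ltr_wpDl // mulr_ge0.
have [p0 [Fp0 ep0]] := exists_sofic_index F (divr_gt0 r0 QS).
exists p0 => // p /= /andP[p0p ep].
have [approx phiV] := phi_sofic p.
have Fp : (F `<=` idx_set p)%fset by apply: fsubset_trans p0p.
have phiVF g : g \in F -> phi p g^-1%g = (phi p g)^-1%g.
  by move=> /(fsubsetP Fp); exact: phiV.
have Xc : sqbounded c (X p).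
  rewrite /X -kmx_adj => [u|i j t /Eb[tE _]].
    apply: le_trans (sqbounded_kmx _ _ _) _.
    by rewrite ler_wpM2r ?nsq_ge0 // lerDl.
  apply/phiVF/(fsubsetP (wball_sub E1 (ltn0Sn _))).
  exact: (fsubsetP (E_sub_wball1 E)).
split=> //.
have := trace_estimate E1 Eb (fsubset_refl F) (phi1 p) phiVF c_gt0 Xc (leqnn k).
have eps0 : 0 <= idx_eps p by have /andP[/ltW] := idx_eps_bounds p.
have := card_bad_vertices approx Fp eps0.
rewrite -/(X p) -/(T p) -/(tr p k) -/S -/F -/Q; move: (#|_|) => bad bad_le est.
rewrite -[trace_pow b c k](mulKf (lt0r_neq0 (m_gt0 p))) [_^-1 * _]mulrC -mulrBl.
rewrite normrM normfV normr_nat ltr_pdivrMr //; apply: le_lt_trans est _.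
have -> : bad%:R * S = (bad%:R * S')%:C%C by rewrite rmorphM rmorph_nat S'E.
have -> : r%:C%C * (m p)%:R = (r * (m p)%:R)%:C%C by rewrite rmorphM rmorph_nat.
have mR : 0 < (m p)%:R :> R by have [m0 _ _ _] := approx; rewrite ltr0n.
rewrite ltcR; apply: (@le_lt_trans _ _ (Q * (idx_eps p * (m p)%:R) * S')).
  by rewrite ler_wpM2r.
rewrite mulrA mulrAC ltr_pM2r //.
apply: (@le_lt_trans _ _ (Q * S' * (r / (Q * S' + 1)))).
  by rewrite mulrAC ler_wpM2l ?mulr_ge0 //; apply: le_trans ep ep0.
by rewrite mulrCA mulrC gtr_pMl // ltr_pdivrMr // mul1r ltrDl.
Qed.

Let trace_pow_ge0 k : 0 <= trace_pow b c k.
Proof.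
apply: ge0_closed => e e0; have FF := @sofic_limit_filter R G.
have [p [Xc pe]] := filter_ex (near_trace k e0).
exists (tr p k / (m p)%:R) => //.
by rewrite divr_ge0 // mxtrace_iter_ge0.
Qed.

Let trace_powS k : trace_pow b c k.+1 <= trace_pow b c k.
Proof.
rewrite -subr_ge0; apply: ge0_closed => e e0; have FF := @sofic_limit_filter R G.
have e2 : 0 < e / 2 by rewrite divr_gt0.
have [p [[Xc pe] [_ pe']]] := filter_ex (filterI (near_trace k e2) (near_trace k.+1 e2)).
exists (tr p k / (m p)%:R - tr p k.+1 / (m p)%:R).
  by rewrite -mulrBl divr_ge0 // subr_ge0 mxtrace_iterS.
set x := tr p k / _ in pe *; set y := tr p k.+1 / _ in pe' *.
have -> : x - y - (trace_pow b c k - trace_pow b c k.+1) =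
  (x - trace_pow b c k) - (y - trace_pow b c k.+1) by ring.
rewrite [e]splitr; apply: le_lt_trans (ler_normB _ _) _.
exact: ltrD.
Qed.

(** The assumptions of [vN_dim_eq0] on the traces hold because these are limits
    of the normalised traces of powers of positive contractions. *)
Lemma vN_dim_eigenspace_eq0 : vN_dim (l2_eigenspace AC lam) = 0 <->
  forall x, l2_eigenspace AC lam x -> forall i g, x i g = 0.
Proof.
by rewrite -kernel_space_shift_grmx; exact: vN_dim_eq0 c_gt0 trace_pow_ge0 trace_powS.
Qed.

Lemma geometric_small (q e : C) : 0 <= q < 1 -> 0 < e ->
  exists K, forall k, (K <= k)%N -> q ^+ k < e.
Proof.
move=> /andP[q0 q1] /pos_complexP[r r0 ->].
have qE : q = (complex.Re q)%:C%C by rewrite RRe_real // ger0_real.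
have : `|complex.Re q| < 1.
  have z0 : 0 <= complex.Re q by rewrite -ler0c -qE.
  by rewrite ger0_norm // -ltcR -qE.
move=> /cvg_expr/cvgrPdist_lt/(_ r r0)[K _ HK]; exists K => k /HK /=.
rewrite sub0r normrN => h; rewrite qE -rmorphXn /= ltcR.
exact: le_lt_trans (ler_norm _) h.
Qed.

Let dimk p := dim_ker (lam%:M - perm_lin_mx (phi p) AC).

Let dimkE p : dimk p = (\sum_(i < n) m p - \rank (X p))%N.
Proof.
rewrite /dimk /dim_ker mxrank_coker -(kmx_shift_grmx (phi1 p)); congr (_ - _)%N.
by rewrite /X mxrank_map mxrank_tr.
Qed.

(** For a [k] chosen once and for all, the normalised trace [y] of [S_p^k] is
    near the dimension [kappa]; the normalised kernel dimension [x] is at most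
    [y], and at least [y] minus the share of the small singular values and
    minus the [k]-th power of a number less than 1. *)
Lemma dim_ker_cvg :
  (fun p => (dimk p)%:R / (m p)%:R : C^o) @ @sofic_limit R G
    --> (vN_dim (l2_eigenspace AC lam) : C^o).
Proof.
have FF := @sofic_limit_filter R G.
rewrite -kernel_space_shift_grmx.
have lim := vN_dim_lim c_gt0 trace_pow_ge0 trace_powS.
set kappa := vN_dim _ in lim *; apply/cvgrPdist_lt => e e0.
pose d := e / 5; have d0 : 0 < d by rewrite divr_gt0.
have [rd rd0 rdE] := pos_complexP d0.
pose L := (Num.truncn (2 * n%:R / rd)).+1.
have L0 : 0 < L%:R :> C by rewrite ltr0n.
have Ld : 2 * n%:R / L%:R < d.
  have : 2 * n%:R / rd < L%:R by exact: truncnS_gt.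
  rewrite ltr_pdivrMr // [L%:R * _]mulrC => H; rewrite ltr_pdivrMr // rdE.
  have -> : 2 * n%:R = (2 * n%:R : R)%:C%C :> C by rewrite rmorphM !rmorph_nat.
  have -> : rd%:C%C * L%:R = (rd * L%:R)%:C%C :> C by rewrite rmorphM rmorph_nat.
  by rewrite ltcR.
pose K := 2 * (`|lam^*| ^+ 2 + c).
have K0 : 0 <= K by rewrite mulr_ge0 // addr_ge0 ?exprn_ge0 // ltW.
have [a /andP[a0 a1] small] := few_small_sval2 (lam^*) K0 (ltn0Sn _ : (0 < L)%N).
have ac : a <= c by apply: le_trans c_ge1.
have q01 : 0 <= 1 - a / c < 1.
  by rewrite subr_ge0 ler_pdivrMr // mul1r ac gtrBl divr_gt0.
have n1 : 0 < n%:R + 1 :> C by rewrite ltr_wpDl.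
have [K1 HK1] := geometric_small q01 (divr_gt0 d0 n1).
have [K2 HK2] := lim _ d0.
pose k := maxn K1 K2.
have nq : n%:R * (1 - a / c) ^+ k < d.
  have := HK1 k (leq_maxl _ _); rewrite ltr_pdivlMr // => H; apply: le_lt_trans H.
  rewrite mulrC ler_wpM2l ?exprn_ge0 ?lerDl //; by case/andP: q01.
have kd := HK2 k (leq_maxr _ _).
apply: filterS (near_trace k d0) => p [Xc pd] /=.
have mp := m_gt0 p.
have dl : (dimk p)%:R <= tr p k.
  by rewrite dimkE; exact: corank_le_mxtrace.
have XE : X p = lam^*%:M - map_mx intr (int_perm_mx (phi p))^T.
  rewrite /X kmx_shift_grmx // perm_lin_mx_int raddfB /= tr_scalar_mx map_mxB.
  congr (_ - _); first by rewrite map_scalar_mx.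
  by apply/matrixP => i j; rewrite !mxE /= rmorph_int.
have MK : sqbounded K (map_mx intr (int_perm_mx (phi p))^T : 'M[C]__).
  have -> : map_mx intr (int_perm_mx (phi p))^T = lam^*%:M - X p :> 'M[C]__.
    by rewrite XE opprB addrCA subrr addr0.
  exact: sqbounded_shift.
have := small _ _ MK; rewrite -XE => sm.
have du := mxtrace_le_corank c_gt0 Xc k a0 ac.
rewrite -/(T p) -/(tr p k) -dimkE in du.
have sumE : (\sum_(i < n) m p = n * m p)%N by rewrite sum_nat_const card_ord.
set t := #|_| in sm du.
have tL : t%:R / (m p)%:R < d.
  apply: le_lt_trans Ld; rewrite ler_pdivrMr // mulrAC ler_pdivlMr //.
  by rewrite -mulrA -!natrM ler_nat mulnC -sumE.
have lo : tr p k / (m p)%:R <= (dimk p)%:R / (m p)%:R + d + d.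
  rewrite ler_pdivrMr // !mulrDl divfK ?gt_eqF //; apply: le_trans du _.
  apply: lerD; first by rewrite lerD2l -ler_pdivrMr // ltW.
  by rewrite sumE natrM mulrAC ler_wpM2r // ltW.
have hi : (dimk p)%:R / (m p)%:R <= tr p k / (m p)%:R by rewrite ler_pM2r ?invr_gt0.
set x := (dimk p)%:R / _ in lo hi *; set y := tr p k / _ in lo hi pd.
have xy : `|y - x| <= d + d by rewrite ger0_norm ?subr_ge0 // lerBlDl addrA.
have -> : kappa - x = (y - x) - (y - trace_pow b c k) - (trace_pow b c k - kappa) by ring.
have -> : e = (d + d) + d + d + d by rewrite /d; field.
apply: (@lt_trans _ _ (d + d + d + d)); last by rewrite ltrDl.
apply: le_lt_trans (ler_normB _ _) _; apply: ltrD => //.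
by apply: le_lt_trans (ler_normB _ _) _; exact: ler_ltD.
Qed.

End Approximation.

(** * Galois conjugates *)

Section GaloisConjugates.
Local Open Scope sesquilinear_scope.
Context {R : realType}.
Local Notation C := R[i].

Lemma minpoly_dvdp (a : C) p (q : {poly rat}) :
  is_minpoly a p -> root (map_poly ratr q) a -> p %| q.
Proof.
move=> [pm pa pmin] qa; rewrite /dvdp; apply: contraT => r0.
have ra : root (map_poly ratr (q %% p)) a.
  rewrite rootE; move: qa; rewrite rootE {1}(divp_eq q p) rmorphD rmorphM /=.
  by rewrite hornerD hornerM (eqP pa) mulr0 add0r.
by have := pmin _ r0 ra; rewrite leqNgt ltn_modp monic_neq0.
Qed.

(** If [q] vanishes at [b], so does the gcd of [q] and the minimal polynomial
    [p] of [a]. This gcd is thus not constant, its cofactor in [p] is too small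
    to vanish at [a] by minimality, and the gcd itself vanishes at [a]. *)
Lemma root_galois_conj (a b : C) (q : {poly rat}) : galois_conj a b ->
  root (map_poly ratr q) a = root (map_poly ratr q) b.
Proof.
move=> [p minp pb]; apply/idP/idP => [qa|qb].
  have /dvdpP[h ->] := minpoly_dvdp minp qa.
  by rewrite rmorphM rootM pb orbT.
have [pm pa pmin] := minp.
have p0 := monic_neq0 pm.
have gb : root (map_poly ratr (gcdp p q)) b by rewrite gcdp_map root_gcd pb.
have /dvdpP[k qE] := dvdp_gcdr p q; have /dvdpP[h pE] := dvdp_gcdl p q.
move: (gcdp p q) gb qE pE => g gb qE pE; rewrite qE rmorphM rootM.
have h0 : h != 0 by apply: contraNneq p0 => h0; rewrite pE h0 mul0r.
have g0 : g != 0 by apply: contraNneq p0 => g0; rewrite pE g0 mulr0.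
have : root (map_poly ratr (h * g)) a by rewrite -pE.
rewrite rmorphM rootM => /orP[ha|->]; last by rewrite orbT.
have g1 : (size g <= 1)%N.
  have := pmin _ h0 ha; have -> : size p = (size h + size g).-1.
    by rewrite pE; exact: size_mul.
  by move: h0; rewrite -size_poly_gt0; move: (size h) (size g); clear => x y; lia.
have gE := size1_polyC g1; move: gb; rewrite gE map_polyC rootC fmorph_eq0 => /eqP g00.
by case/negP: g0; rewrite gE g00 polyC0.
Qed.

Lemma rank_mxsub_le r k (B : 'M[C]_k) (f g : 'I_r -> 'I_k) :
  mxsub f g B \in unitmx -> (r <= \rank B)%N.
Proof.
move=> /mxrank_unit {1}<-; rewrite mxsub_eq_mul.
by apply: leq_trans (mxrankM_maxl _ _) _; exact: mxrankM_maxr.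
Qed.

(** A maximal nonzero minor at [a] remains nonzero at [b]. *)
Lemma rank_galois_le (a b : C) k (M : 'M[int]_k) : 
    (forall q : {poly rat}, root (map_poly ratr q) a = root (map_poly ratr q) b) ->
  (\rank (a%:M - map_mx intr M : 'M[C]_k)%R <= \rank (b%:M - map_mx intr M : 'M[C]_k)%R)%N.
Proof.
move=> ab; have [f [g [_ _ unit]]] := exists_unit_minor (a%:M - map_mx intr M : 'M[C]_k).
apply: (@rank_mxsub_le _ _ _ f g); move: unit.
rewrite !unitmxE !unitfE -!horner_minor_poly -!rootE.
have E : map_poly intr (minor_poly f g M) =
         map_poly ratr (map_poly intr (minor_poly f g M) : {poly rat}) :> {poly C}.
  by rewrite -map_poly_comp; apply: eq_map_poly => z /=; rewrite ratr_int.
by rewrite E ab.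
Qed.

Lemma dim_kerE k (M : 'M[C]_k) : dim_ker M = (k - \rank M)%N.
Proof. exact: mxrank_coker. Qed.

Lemma dim_ker_galois_conj (a b : C) k (M : 'M[int]_k) : galois_conj a b ->
  dim_ker (a%:M - map_mx intr M : 'M[C]_k) =
  dim_ker (b%:M - map_mx intr M : 'M[C]_k).
Proof.
move=> ab; have rE : \rank (a%:M - map_mx intr M : 'M[C]_k)%R =
                     \rank (b%:M - map_mx intr M : 'M[C]_k)%R.
  apply/eqP; rewrite eqn_leq; apply/andP.
  by split; apply: rank_galois_le => q; rewrite (root_galois_conj q ab).
by rewrite !dim_kerE rE.
Qed.

Lemma algebraic_integer_dim_ker (lam : C) k (M : 'M[int]_k) :
  dim_ker (lam%:M - map_mx intr M : 'M[C]_k) != 0%N -> algebraic_integer lam.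
Proof.
move=> d0; exists (char_poly M); first exact: char_poly_monic.
rewrite map_char_poly rootE -det_shift; apply: contraNT d0 => det0.
by rewrite /dim_ker mxrank_coker mxrank_unit ?subnn // unitmxE unitfE.
Qed.

End GaloisConjugates.

Lemma l2_eigenvalueP {R : realType} {G : groupType} (n : nat)
    (A : 'M[gring G int]_n) (m : sofic_index R G -> nat)
    (phi : forall p : sofic_index R G, G -> 'S_(m p)) (lam : R[i]) :
  sofic_family phi ->
  l2_eigenvalue (map_mx (gring_map intr) A) lam <->
  vN_dim (l2_eigenspace (map_mx (gring_map intr) A) lam) <> 0.
Proof.
move=> Hphi; rewrite (vN_dim_eigenspace_eq0 A Hphi); split.
  by move=> [x Vx [i [g xg]]] /(_ x Vx i g) x0; rewrite x0 eqxx in xg.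
move=> H; apply: contrapT => noeig; apply: H => x Vx i g; apply/eqP.
by apply: contrapT => /negP xg; apply: noeig; exists x => //; exists i, g.
Qed.

Theorem theorem4p2 (R : realType) (G : groupType) (n : nat)
    (A : 'M[gring G int]_n) (m : sofic_index R G -> nat)
    (phi : forall p : sofic_index R G, G -> 'S_(m p)) :
  sofic R G -> (0 < n)%N -> sofic_family phi ->
  let AC : 'M[gring G R[i]]_n := map_mx (gring_map intr) A in
  [/\ forall lam : R[i], l2_eigenvalue AC lam -> algebraic_integer lam,
      forall lam : R[i],
        (fun p => (dim_ker (lam%:M - perm_lin_mx (phi p) AC))%:R / (m p)%:R
                  : (R[i])^o) @ @sofic_limit R G
          --> (vN_dim (l2_eigenspace AC lam) : (R[i])^o)
    & forall a b : R[i], l2_eigenvalue AC a -> galois_conj a b ->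
        l2_eigenvalue AC b /\
        vN_dim (l2_eigenspace AC b) = vN_dim (l2_eigenspace AC a)].
Proof.
move=> _ _ Hphi AC; have FF := @sofic_limit_filter R G.
have cvg lam := @dim_ker_cvg R G n A m phi Hphi lam.
have uniq (f : sofic_index R G -> (R[i])^o) (l l' : (R[i])^o) :
    f @ @sofic_limit R G --> l -> f @ @sofic_limit R G --> l' -> l = l'.
  move=> fl; rewrite -(@cvg_lim _ (@norm_hausdorff R[i] (R[i])^o) _ _ FF _ _ fl).
  exact: (@cvg_lim _ (@norm_hausdorff R[i] (R[i])^o) _ _ FF).
split=> [lam /(l2_eigenvalueP A lam Hphi) dim0||a b /(l2_eigenvalueP A a Hphi) dima ab].
- apply: contrapT => notint; apply: dim0; apply: uniq (cvg lam) _.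
  apply/cvgrPdist_lt => e e0; near=> p; rewrite perm_lin_mx_int.
  have /eqP -> : dim_ker (lam%:M - map_mx intr (int_perm_mx A (phi p))) == 0%N.
    by apply/negPn/negP => /algebraic_integer_dim_ker.
  by rewrite mul0r subrr normr0.
- exact: cvg.
have dimE : vN_dim (l2_eigenspace AC b) = vN_dim (l2_eigenspace AC a).
  pose D lam : sofic_index R G -> (R[i])^o :=
    fun p => (dim_ker (lam%:M - perm_lin_mx (phi p) AC))%:R / (m p)%:R.
  have Dab : D a = D b.
    apply/funext => p; rewrite /D perm_lin_mx_int.
    by rewrite (dim_ker_galois_conj (int_perm_mx A (phi p)) ab).
  by apply: (uniq (D b)); [exact: cvg b | rewrite -Dab; exact: cvg a].
by split=> //; apply/(l2_eigenvalueP A b Hphi); rewrite dimE.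
Unshelve. all: by end_near.
Qed.
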